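(* Let $H=\{H_\alpha\}_{\alpha\in\pi}$ be a finite dimensional unimodular ribbon Hopf $\pi$-coalgebra with crossing $\varphi$ and twist $\theta=\{\theta_\alpha\}_{\alpha\in\pi}$. Let $\lambda=(\lambda_\alpha)_{\alpha\in\pi}$ be a right $\pi$-integral for $H$ and let $G_\alpha=\theta_\alpha u_\alpha$ for $\alpha\in\pi$, where the $u_\alpha$ are the Drinfeld elements of $H$. Suppose that at least one of the following conditions holds: (a) $H$ is semisimple; (b) $H$ is cosemisimple; (c) $\lambda_1(\theta_1)\neq0$; (d) $\varphi_\beta|_{H_1}=\mathrm{id}_{H_1}$ for all $\beta\in\pi$. Then $\mathrm{tr}=(\mathrm{tr}_\alpha)_{\alpha\in\pi}$, defined by $\mathrm{tr}_\alpha(x)=\lambda_\alpha(G_\alpha x)$ for all $\alpha\in\pi$ and $x\in H_\alpha$, is a $\pi$-trace for $H$.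
   Context: Throughout, $\pi$ is a discrete group with neutral element $1$, $\Bbbk$ is a field, $\otimes=\otimes_\Bbbk$, and algebras are associative and unital over $\Bbbk$ (the zero algebra is allowed). A $\pi$-coalgebra is a family $C=\{C_\alpha\}_{\alpha\in\pi}$ of $\Bbbk$-spaces with $\Bbbk$-linear maps $\Delta_{\alpha,\beta}:C_{\alpha\beta}\to C_\alpha\otimes C_\beta$ and $\epsilon:C_1\to\Bbbk$ such that $(\Delta_{\alpha,\beta}\otimes\mathrm{id}_{C_\gamma})\Delta_{\alpha\beta,\gamma}=(\mathrm{id}_{C_\alpha}\otimes\Delta_{\beta,\gamma})\Delta_{\alpha,\beta\gamma}$ and $(\mathrm{id}_{C_\alpha}\otimes\epsilon)\Delta_{\alpha,1}=\mathrm{id}_{C_\alpha}=(\epsilon\otimes\mathrm{id}_{C_\alpha})\Delta_{1,\alpha}$ for all $\alpha,\beta,\gamma\in\pi$. A Hopf $\pi$-coalgebra is a $\pi$-coalgebra $H=(\{H_\alpha\},\Delta,\epsilon)$ with $\Bbbk$-linear maps $S_\alpha:H_\alpha\to H_{\alpha^{-1}}$ such that each $H_\alpha$ is an algebra with multiplication $m_\alpha$ and unit $1_\alpha$, the maps $\epsilon$ and all $\Delta_{\alpha,\beta}$ are algebra homomorphisms, and $m_\alpha(S_{\alpha^{-1}}\otimes\mathrm{id}_{H_\alpha})\Delta_{\alpha^{-1},\alpha}=\epsilon 1_\alpha=m_\alpha(\mathrm{id}_{H_\alpha}\otimes S_{\alpha^{-1}})\Delta_{\alpha,\alpha^{-1}}$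 for all $\alpha$. $H_1$ is an ordinary Hopf algebra. $H$ is finite dimensional if every $H_\alpha$ is. A crossed Hopf $\pi$-coalgebra is one endowed with a crossing: $\Bbbk$-linear maps $\varphi_\beta:H_\alpha\to H_{\beta\alpha\beta^{-1}}$ ($\alpha,\beta\in\pi$) that are algebra isomorphisms with $(\varphi_\beta\otimes\varphi_\beta)\Delta_{\alpha,\gamma}=\Delta_{\beta\alpha\beta^{-1},\beta\gamma\beta^{-1}}\varphi_\beta$, $\epsilon\varphi_\beta=\epsilon$, and $\varphi_{\beta\beta'}=\varphi_\beta\varphi_{\beta'}$. Let $\sigma_{\beta,\alpha}:H_\beta\otimes H_\alpha\to H_\alpha\otimes H_\beta$ be the flip. A quasitriangular Hopf $\pi$-coalgebra is a crossed one with invertible elements $R_{\alpha,\beta}\in H_\alpha\otimes H_\beta$ ($\alpha,\beta\in\pi$) such that for all $\alpha,\beta,\gamma\in\pi$: (i) $R_{\alpha,\beta}\cdot\Delta_{\alpha,\beta}(x)=\sigma_{\beta,\alpha}(\varphi_{\alpha^{-1}}\otimes\mathrm{id}_{H_\alpha})\Delta_{\alpha\beta\alpha^{-1},\alpha}(x)\cdot R_{\alpha,\beta}$ for all $x\in H_{\alpha\beta}$; (ii) $(\mathrm{id}_{H_\alpha}\otimes\Delta_{\beta,\gamma})(R_{\alpha,\beta\gamma})=(R_{\alpha,\gamma})_{1\beta3}\cdot(R_{\alpha,\beta})_{12\gamma}$ and $(\Delta_{\alpha,\beta}\otimes\mathrm{id}_{H_\gamma})(R_{\alpha\beta,\gamma})=[(\mathrm{id}_{H_\alpha}\otimes\varphi_{\beta^{-1}})(R_{\alpha,\beta\gamma\beta^{-1}})]_{1\beta3}\cdot(R_{\beta,\gamma})_{\alpha23}$,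 where for $r=\sum_jp_j\otimes q_j$ one sets $r_{12\gamma}=r\otimes1_\gamma$, $r_{\alpha23}=1_\alpha\otimes r$, $r_{1\beta3}=\sum_jp_j\otimes1_\beta\otimes q_j$; (iii) $(\varphi_\beta\otimes\varphi_\beta)(R_{\alpha,\gamma})=R_{\beta\alpha\beta^{-1},\beta\gamma\beta^{-1}}$. Its Drinfeld elements are $u_\alpha=m_\alpha(S_{\alpha^{-1}}\varphi_\alpha\otimes\mathrm{id}_{H_\alpha})\sigma_{\alpha,\alpha^{-1}}(R_{\alpha,\alpha^{-1}})\in H_\alpha$. A ribbon Hopf $\pi$-coalgebra is a quasitriangular one with invertible elements $\theta_\alpha\in H_\alpha$ (the twist) such that for all $\alpha,\beta$: $\varphi_\alpha(x)=\theta_\alpha^{-1}x\theta_\alpha$ for $x\in H_\alpha$; $S_\alpha(\theta_\alpha)=\theta_{\alpha^{-1}}$; $\varphi_\beta(\theta_\alpha)=\theta_{\beta\alpha\beta^{-1}}$; $\Delta_{\alpha,\beta}(\theta_{\alpha\beta})=(\theta_\alpha\otimes\theta_\beta)\cdot\sigma_{\beta,\alpha}((\varphi_{\alpha^{-1}}\otimes\mathrm{id}_{H_\alpha})(R_{\alpha\beta\alpha^{-1},\alpha}))\cdot R_{\alpha,\beta}$. A right $\pi$-integral for $H$ is a family $\lambda\in\prod_\alpha H_\alpha^*$ with $(\lambda_\alpha\otimes\mathrm{id}_{H_\beta})\Delta_{\alpha,\beta}=\lambda_{\alpha\beta}\,1_\beta$ for all $\alpha,\beta$. $H$ is unimodular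 if the spaces of left and right integrals of the Hopf algebra $H_1$ coincide (elements $\Lambda\in H_1$ with $x\Lambda=\epsilon(x)\Lambda$, resp. $\Lambda x=\epsilon(x)\Lambda$, for all $x\in H_1$). $H$ is semisimple if each algebra $H_\alpha$ is semisimple. $H$ is cosemisimple if it is cosemisimple as a right $\pi$-comodule over itself: a $\pi$-subcomodule of $H$ is a family of subspaces $N_\alpha\subset H_\alpha$ with $\Delta_{\alpha,\beta}(N_{\alpha\beta})\subset N_\alpha\otimes H_\beta$; it is simple if it is non-zero (some $N_\alpha\neq0$) and contains no $\pi$-subcomodules other than $0$ and itself; $H$ is cosemisimple if it is a (componentwise) direct sum of simple $\pi$-subcomodules. A $\pi$-trace for a crossed Hopf $\pi$-coalgebra $H$ is a family $\mathrm{tr}=(\mathrm{tr}_\alpha)_{\alpha}\in\prod_\alpha H_\alpha^*$ such that for all $\alpha,\beta\in\pi$, $x,y\in H_\alpha$: $\mathrm{tr}_\alpha(xy)=\mathrm{tr}_\alpha(yx)$; $\mathrm{tr}_{\alpha^{-1}}(S_\alpha(x))=\mathrm{tr}_\alpha(x)$; $\mathrm{tr}_{\beta\alpha\beta^{-1}}(\varphi_\beta(x))=\mathrm{tr}_\alpha(x)$. *)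

(* Defs.v *)
From HB Require Import structures.
From mathcomp Require Import all_boot all_order all_fingroup all_algebra.

Set Implicit Arguments.
Unset Strict Implicit.
Unset Printing Implicit Defensive.

Import GRing.Theory VectorInternalTheory.
Local Open Scope ring_scope.

(* Finite dimensional associative unital algebras, the zero algebra included  *)
(* (it is excluded from [algType] and [falgType]).                            *)
HB.mixin Record Vector_isFdAlg (k : fieldType) A of Vector k A := {
  fd_one : A;
  fd_mul : A -> A -> A;
  fd_mulA : associative fd_mul;
  fd_mul1r : left_id fd_one fd_mul;
  fd_mulr1 : right_id fd_one fd_mul;
  fd_mulDl : left_distributive fd_mul +%R;
  fd_mulDr : right_distributive fd_mul +%R;
  fd_scalerAl : forall (c : k) (x y : A), c *: fd_mul x y = fd_mul (c *: x) y;
  fd_scalerAr : forall (c : k) (x y : A), c *: fd_mul x y = fd_mul x (c *: y)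
}.

#[short(type="fdAlgType")]
HB.structure Definition FdAlg (k : fieldType) :=
  {A of Vector_isFdAlg k A & Vector k A}.

Section FdAlgRing.
Variables (k : fieldType) (A : fdAlgType k).

(* A [PzRing] instance on the sort rather than an inherited structure: there  *)
(* is no MathComp structure joining [PzRing] and [Lmodule] below [Lalgebra].  *)
#[non_forgetful_inheritance]
HB.instance Definition _ := GRing.Zmodule_isPzRing.Build (FdAlg.sort A)
  (@fd_mulA k A) (@fd_mul1r k A) (@fd_mulr1 k A) (@fd_mulDl k A) (@fd_mulDr k A).

Lemma fdscalerAl (c : k) (x y : A) : c *: (x * y) = (c *: x) * y.
Proof. exact: fd_scalerAl. Qed.

Lemma fdscalerAr (c : k) (x y : A) : c *: (x * y) = x * (c *: y).
Proof. exact: fd_scalerAr. Qed.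

End FdAlgRing.

(* Tensor products of finite dimensional spaces, as coordinate matrices with  *)
(* respect to the bases provided by the [vectType] structures; [tliftE],      *)
(* [tlift_linear] and [tlift_uniq] establish the universal property.          *)
Definition tens (k : fieldType) (V W : vectType k) : Type :=
  'M[k]_(dim V, dim W).

HB.instance Definition _ (k : fieldType) (V W : vectType k) :=
  Vector.on (tens V W).

Section Tensor.
Variable k : fieldType.
Implicit Types V W U : vectType k.

Definition pure V W (v : V) (w : W) : tens V W :=
  \matrix_(i, j) (v2r v 0 i * v2r w 0 j).

Definition coord_basis V (i : 'I_(dim V)) : V := r2v (delta_mx 0 i).

(* The linear map V (x) W -> U induced by b; it depends on the coordinates    *)
(* unless b is bilinear, as it is in every use below.                         *)
Definition tlift V W (U : lmodType k) (b : V -> W -> U) (t : tens V W) : U :=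
  \sum_i \sum_j t i j *: b (coord_basis i) (coord_basis j).

Definition bilin V W (U : lmodType k) (b : V -> W -> U) : Prop :=
  (forall v, linear (b v)) /\ (forall w, linear (b^~ w)).

Definition tmap V W V' W' (f : V -> V') (g : W -> W') : tens V W -> tens V' W' :=
  tlift (fun v w => pure (f v) (g w)).

Definition tswap V W : tens V W -> tens W V := tlift (fun v w => pure w v).

Definition tassoc V W U : tens (tens V W) U -> tens V (tens W U) :=
  tlift (fun t u => tlift (fun v w => pure v (pure w u)) t).

Definition tensv V W (M : {vspace V}) (N : {vspace W}) : {vspace tens V W} :=
  <<[seq pure v w | v <- vbasis M, w <- vbasis N]>>%VS.

Lemma coord_basisE V (v : V) : v = \sum_i v2r v 0 i *: coord_basis i.
Proof.
rewrite -{1}[v]v2rK {1}(row_sum_delta (v2r v)) linear_sum.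
by apply: eq_bigr => i _; rewrite linearZ.
Qed.

Lemma pure_linearr V W (v : V) : linear (@pure V W v).
Proof. by move=> c w w'; apply/matrixP=> i j; rewrite !mxE linearP !mxE mulrDr mulrCA. Qed.

Lemma pure_linearl V W (w : W) : linear ((@pure V W)^~ w).
Proof. by move=> c v v'; apply/matrixP=> i j; rewrite !mxE linearP !mxE mulrDl mulrA. Qed.

Lemma pure_bilin V W : bilin (@pure V W).
Proof. by split; [apply: pure_linearr | apply: pure_linearl]. Qed.

Lemma tlift_linear V W (U : lmodType k) (b : V -> W -> U) : linear (tlift b).
Proof.
move=> c s t; rewrite /tlift scaler_sumr -big_split; apply: eq_bigr => i _.
rewrite scaler_sumr -big_split; apply: eq_bigr => j _ /=.
by rewrite !mxE scalerDl scalerA.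
Qed.

HB.instance Definition _ V W (U : lmodType k) (b : V -> W -> U) :=
  GRing.isLinear.Build k (tens V W) U _ (tlift b) (tlift_linear b).

Lemma linear_lincomb (V U : lmodType k) (f : V -> U) n (c : 'I_n -> k) x :
  linear f -> f (\sum_i c i *: x i) = \sum_i c i *: f (x i).
Proof.
move=> lf; pose F := GRing.isLinear.Build k V U _ f lf.
pose g : {linear V -> U} := HB.pack f F.
by rewrite -[f]/(g : V -> U) linear_sum; apply: eq_bigr => i _; rewrite linearZ.
Qed.

Lemma tliftE V W (U : lmodType k) (b : V -> W -> U) v w :
  bilin b -> tlift b (pure v w) = b v w.
Proof.
case=> br bl; rewrite {2}[v]coord_basisE (linear_lincomb _ _ (bl w)).
apply: eq_bigr => i _; rewrite {2}[w]coord_basisE (linear_lincomb _ _ (br _)).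
by rewrite scaler_sumr; apply: eq_bigr => j _; rewrite mxE scalerA.
Qed.

Lemma tens_sumE V W (t : tens V W) :
  t = \sum_i \sum_j pure (t i j *: coord_basis i) (coord_basis j).
Proof.
rewrite {1}[t]matrix_sum_delta; apply: eq_bigr => i _; apply: eq_bigr => j _.
apply/matrixP=> i' j'; rewrite !mxE linearZ !mxE /= !r2vK !mxE.
by rewrite !eqxx -mulrA -natrM mulnb.
Qed.

Lemma tens_ind V W (P : tens V W -> Prop) :
    (forall v w, P (pure v w)) -> (forall s t, P s -> P t -> P (s + t)) ->
  forall t, P t.
Proof.
move=> Pp PD t; have P0 : P 0.
  suff -> : 0 = pure (0 : V) (0 : W) by [].
  by apply/matrixP=> i j; rewrite !mxE linear0 !mxE mul0r.
by rewrite [t]tens_sumE; apply: big_ind => // i _; apply: big_ind.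
Qed.

Lemma tlift_uniq V W (U : lmodType k) (b : V -> W -> U) (f : tens V W -> U) :
  linear f -> (forall v w, f (pure v w) = b v w) -> f =1 tlift b.
Proof.
move=> lf fb t; pose F := GRing.isLinear.Build k (tens V W) U _ f lf.
pose g : {linear tens V W -> U} := HB.pack f F.
rewrite {1}[t]tens_sumE -[f]/(g : _ -> U) linear_sum; apply: eq_bigr => i _.
rewrite linear_sum; apply: eq_bigr => j _; rewrite -fb.
suff -> : pure (t i j *: coord_basis i) (coord_basis j) =
          t i j *: pure (coord_basis i) (coord_basis j) by rewrite linearZ.
by apply/matrixP=> i' j'; rewrite !mxE linearZ !mxE mulrA.
Qed.

End Tensor.

Section TensorAlgebra.
Variable k : fieldType.
Variables A B : fdAlgType k.
Local Notation T := (tens A B).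
Implicit Types s t u : T.

Definition tens_one : T := pure (1 : A) (1 : B).
Definition tens_mul s t : T :=
  tlift (fun (a : A) (b : B) =>
    tlift (fun (a' : A) (b' : B) => pure (a * a') (b * b')) t) s.

Lemma tens_mul_linl t : linear (tens_mul^~ t).
Proof. exact: tlift_linear. Qed.

Lemma tens_mul_linr s : linear (tens_mul s).
Proof.
move=> c t t'; rewrite /tens_mul [X in X = _]/tlift.
rewrite [X in _ = c *: X + _]/tlift [X in _ = _ + X]/tlift.
rewrite scaler_sumr -big_split.
apply: eq_bigr => i _; rewrite scaler_sumr -big_split; apply: eq_bigr => j _ /=.
rewrite linearP scalerDr; congr (_ + _).
by rewrite !scalerA mulrC.
Qed.

Lemma tens_mulDl : left_distributive tens_mul +%R.
Proof. by move=> s t u; have := tens_mul_linl u 1 s t; rewrite !scale1r. Qed.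

Lemma tens_mulDr : right_distributive tens_mul +%R.
Proof. by move=> s t u; have := tens_mul_linr s 1 t u; rewrite !scale1r. Qed.

Lemma tens_mulE (a a' : A) (b b' : B) :
  tens_mul (pure a b) (pure a' b') = pure (a * a') (b * b').
Proof.
have lin1 x y : bilin (fun (x' : A) (y' : B) => pure (x * x') (y * y') : T).
  split=> [x'|y'] c u v /=; rewrite mulrDr -fdscalerAr.
    exact: pure_linearr.
  exact: pure_linearl.
rewrite /tens_mul tliftE ?tliftE //; split=> [x|y] c u v /=; rewrite !tliftE //.
  by rewrite mulrDl -fdscalerAl; apply: pure_linearr.
by rewrite mulrDl -fdscalerAl; apply: pure_linearl.
Qed.

Lemma tens_mulA : associative tens_mul.
Proof.
move=> s t u; elim/tens_ind: s => [a b|s s' Es Es']; last first.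
  by rewrite !tens_mulDl Es Es'.
elim/tens_ind: t => [a' b'|t t' Et Et']; last first.
  by rewrite !(tens_mulDl, tens_mulDr) Et Et'.
elim/tens_ind: u => [a'' b''|u u' Eu Eu']; last by rewrite !tens_mulDr Eu Eu'.
by rewrite !tens_mulE !mulrA.
Qed.

Lemma tens_mul1r : left_id tens_one tens_mul.
Proof.
move=> t; elim/tens_ind: t => [a b|s t Es Et]; first by rewrite tens_mulE !mul1r.
by rewrite tens_mulDr Es Et.
Qed.

Lemma tens_mulr1 : right_id tens_one tens_mul.
Proof.
move=> t; elim/tens_ind: t => [a b|s t Es Et]; first by rewrite tens_mulE !mulr1.
by rewrite tens_mulDl Es Et.
Qed.

HB.instance Definition _ := GRing.Zmodule_isPzRing.Build T
  tens_mulA tens_mul1r tens_mulr1 tens_mulDl tens_mulDr.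

Lemma tens_scalerAl c s t : c *: tens_mul s t = tens_mul (c *: s) t.
Proof. by rewrite /tens_mul linearZ. Qed.

Lemma tens_scalerAr c s t : c *: tens_mul s t = tens_mul s (c *: t).
Proof.
have E0 : tens_mul s 0 = 0 by exact: (@mulr0 T s).
by have := tens_mul_linr s c t 0; rewrite !addr0 E0 addr0 => ->.
Qed.

HB.instance Definition _ := Vector_isFdAlg.Build k T
  tens_mulA tens_mul1r tens_mulr1 tens_mulDl tens_mulDr
  tens_scalerAl tens_scalerAr.

End TensorAlgebra.

Section Legs.
Variable k : fieldType.
Variables A B C : fdAlgType k.

Definition leg12 (r : tens A B) : tens A (tens B C) :=
  tlift (fun p q => pure p (pure q (1 : C))) r.
Definition leg13 (r : tens A C) : tens A (tens B C) :=
  tlift (fun p q => pure p (pure (1 : B) q)) r.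
Definition leg23 (r : tens B C) : tens A (tens B C) := pure (1 : A) r.

End Legs.

Definition invertible (A : pzRingType) (x : A) : Prop :=
  exists y, y * x = 1 /\ x * y = 1.

Section SemisimpleAlgebra.
Variables (k : fieldType) (A : fdAlgType k).

Definition left_ideal (N : {vspace A}) : Prop :=
  forall a x, x \in N -> a * x \in N.

Definition simple_left_ideal (N : {vspace A}) : Prop :=
  [/\ left_ideal N, N <> 0%VS &
      forall N', left_ideal N' -> (N' <= N)%VS -> N' = 0%VS \/ N' = N].

(* The left regular module is a direct sum of simple submodules; finitely     *)
(* many summands suffice since A is finite dimensional.                       *)
Definition semisimple_algebra : Prop :=
  exists n (N : 'I_n -> {vspace A}),
    [/\ forall i, simple_left_ideal (N i),
        (\sum_i N i)%VS = fullv & directv (\sum_i N i)].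

End SemisimpleAlgebra.

(* Transport along equalities of the index group; as equality proofs in a     *)
(* [choiceType] are unique, the chosen proof is irrelevant.                   *)
Definition cast (I : Type) (T : I -> Type) (i j : I) (e : i = j) (x : T i) :
  T j := ecast l (T l) e x.
Arguments cast {I} T {i j} e x.

Notation cj b a := (b * a * b^-1)%g (only parsing).

Section GroupIdentities.
Variable pi : groupType.
Implicit Types a b c : pi.
Local Open Scope group_scope.

Lemma cj1 b : cj b 1 = 1. Proof. by rewrite mulg1 mulgV. Qed.

Lemma cjM b a c : cj b (a * c) = cj b a * cj b c.
Proof. by rewrite !mulgA mulgVK. Qed.

Lemma cj_inv a : cj a a^-1 = a^-1. Proof. by rewrite mulgV mul1g. Qed.

Lemma cj_id a : cj a a = a. Proof. exact: mulgK. Qed.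

Lemma cj_mul b b' a : cj b (cj b' a) = cj (b * b') a.
Proof. by rewrite invgM !mulgA. Qed.

Lemma cjVK a b : cj a^-1 (cj a b) = b.
Proof. by rewrite invgK !mulgA mulVg mul1g mulgVK. Qed.

End GroupIdentities.

Section PiCoalgebra.
Variables (k : fieldType) (pi : groupType).

Record is_piCoalgebra (C : pi -> vectType k)
    (Delta : forall a b, {linear C (a * b)%g -> tens (C a) (C b)})
    (eps : {scalar C 1%g}) : Prop := IsPiCoalgebra {
  coassoc : forall a b c (x : C (a * b * c)%g),
    tassoc (tmap (Delta a b) idfun (Delta (a * b)%g c x)) =
    tmap idfun (Delta b c) (Delta a (b * c)%g (cast C (esym (mulgA a b c)) x));
  counitr : forall a (x : C a),
    tlift (fun p q => eps q *: p) (Delta a 1%g (cast C (esym (mulg1 a)) x)) = x;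
  counitl : forall a (x : C a),
    tlift (fun p q => eps p *: q) (Delta 1%g a (cast C (esym (mul1g a)) x)) = x
}.

Record hopfPiCoalgebra := HopfPiCoalgebra {
  hopf_sort :> pi -> fdAlgType k;
  Delta : forall a b,
    {linear hopf_sort (a * b)%g -> tens (hopf_sort a) (hopf_sort b)};
  eps : {scalar hopf_sort 1%g};
  antipode : forall a, {linear hopf_sort a -> hopf_sort a^-1%g};
  hopf_coalgebra :
    @is_piCoalgebra (fun a => hopf_sort a : vectType k) Delta eps;
  Delta_morph : forall a b, monoid_morphism (Delta a b);
  eps_morph : monoid_morphism eps;
  antipodel : forall a (x : hopf_sort 1%g),
    tlift (fun p q => cast hopf_sort (invgK a) (antipode a^-1%g p) * q)
      (Delta a^-1%g a (cast hopf_sort (esym (mulVg a)) x)) = eps x *: (1 : hopf_sort a);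
  antipoder : forall a (x : hopf_sort 1%g),
    tlift (fun (p : hopf_sort a) q => p * cast hopf_sort (invgK a) (antipode a^-1%g q))
      (Delta a a^-1%g (cast hopf_sort (esym (mulgV a)) x)) = eps x *: (1 : hopf_sort a)
}.

Definition hcast (H : hopfPiCoalgebra) (a b : pi) (e : a = b) (x : H a) : H b :=
  cast (hopf_sort H) e x.

Record crossedPiCoalgebra := CrossedPiCoalgebra {
  crossed_hopf :> hopfPiCoalgebra;
  phi : forall b a, {linear crossed_hopf a -> crossed_hopf (cj b a)};
  phi_bij : forall b a, bijective (phi b a);
  phi_morph : forall b a, monoid_morphism (phi b a);
  phi_Delta : forall b a c (x : crossed_hopf (a * c)%g),
    tmap (phi b a) (phi b c) (Delta crossed_hopf a c x) =
    Delta crossed_hopf (cj b a) (cj b c)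
      (hcast (cjM b a c) (phi b (a * c)%g x));
  phi_eps : forall b (x : crossed_hopf 1%g),
    eps crossed_hopf (hcast (cj1 b) (phi b 1%g x)) =
    eps crossed_hopf x;
  phi_mul : forall b b' a (x : crossed_hopf a),
    phi (b * b')%g a x =
    hcast (cj_mul b b' a) (phi b (cj b' a) (phi b' a x))
}.

(* phi_(a^-1) as a map H_(a b a^-1) -> H_b *)
Definition phiV (H : crossedPiCoalgebra) a b (x : H (cj a b)) : H b :=
  hcast (cjVK a b) (phi H a^-1%g (cj a b) x).

(* sigma_(b,a) (phi_(a^-1) (x) id) : H_(a b a^-1) (x) H_a -> H_a (x) H_b      *)
Definition swap_phiV (H : crossedPiCoalgebra) a b (t : tens (H (cj a b)) (H a)) :
    tens (H a) (H b) :=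
  tswap (tmap (@phiV H a b) idfun t).

Record qtPiCoalgebra := QtPiCoalgebra {
  qt_crossed :> crossedPiCoalgebra;
  Rmat : forall a b, tens (qt_crossed a) (qt_crossed b);
  Rmat_inv : forall a b, invertible (Rmat a b);
  Rmat_Delta : forall a b (x : qt_crossed (a * b)%g),
    Rmat a b * Delta qt_crossed a b x =
    swap_phiV (Delta qt_crossed (cj a b) a
                 (hcast (esym (mulgVK a (a * b)%g)) x)) * Rmat a b;
  Rmat_Deltar : forall a b c,
    tmap idfun (Delta qt_crossed b c) (Rmat a (b * c)%g) =
    leg13 _ (Rmat a c) * leg12 _ (Rmat a b);
  Rmat_Deltal : forall a b c,
    tassoc (tmap (Delta qt_crossed a b) idfun (Rmat (a * b)%g c)) =
    leg13 _ (tmap idfun (@phiV qt_crossed b c) (Rmat a (cj b c))) *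
    leg23 _ (Rmat b c);
  Rmat_phi : forall b a c,
    tmap (phi qt_crossed b a) (phi qt_crossed b c) (Rmat a c) =
    Rmat (cj b a) (cj b c)
}.

Definition drinfeld (H : qtPiCoalgebra) a : H a :=
  tlift (fun p q => hcast (invgK a) (antipode H a^-1%g
                      (hcast (cj_inv a) (phi H a a^-1%g p))) * q)
    (tswap (Rmat H a a^-1%g)).

Record ribbonPiCoalgebra := RibbonPiCoalgebra {
  ribbon_qt :> qtPiCoalgebra;
  twist : forall a, ribbon_qt a;
  twistV : forall a, ribbon_qt a;
  mulVtwist : forall a, twistV a * twist a = 1;
  multwistV : forall a, twist a * twistV a = 1;
  phi_twist : forall a (x : ribbon_qt a),
    hcast (cj_id a) (phi ribbon_qt a a x) = twistV a * x * twist a;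
  antipode_twist : forall a, antipode ribbon_qt a (twist a) = twist a^-1%g;
  twist_phi : forall b a, phi ribbon_qt b a (twist a) = twist (cj b a);
  Delta_twist : forall a b,
    Delta ribbon_qt a b (twist (a * b)%g) =
    pure (twist a) (twist b) * swap_phiV (Rmat ribbon_qt (cj a b) a)
      * Rmat ribbon_qt a b
}.

Definition left_integral (H : hopfPiCoalgebra) (L : H 1%g) : Prop :=
  forall x, x * L = eps H x *: L.

Definition right_integral (H : hopfPiCoalgebra) (L : H 1%g) : Prop :=
  forall x, L * x = eps H x *: L.

Definition unimodular (H : hopfPiCoalgebra) : Prop :=
  forall L : H 1%g, left_integral L <-> right_integral L.

Definition right_piIntegral (H : hopfPiCoalgebra)
    (lam : forall a, {scalar H a}) : Prop :=
  forall a b (x : H (a * b)%g),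
    tlift (fun p q => lam a p *: q) (Delta H a b x) = lam (a * b)%g x *: (1 : H b).

Definition semisimple (H : hopfPiCoalgebra) : Prop :=
  forall a, semisimple_algebra (H a).

Definition subcomodule (H : hopfPiCoalgebra) (N : forall a, {vspace H a}) :
    Prop :=
  forall a b x, x \in N (a * b)%g -> Delta H a b x \in tensv (N a) (fullv : {vspace H b}).

Definition simple_subcomodule (H : hopfPiCoalgebra)
    (N : forall a, {vspace H a}) : Prop :=
  [/\ subcomodule N, exists a, N a <> 0%VS &
      forall N' : forall a, {vspace H a},
        subcomodule N' -> (forall a, (N' a <= N a)%VS) ->
        (forall a, N' a = 0%VS) \/ (forall a, N' a = N a)].

(* The index type I of the summands may be infinite, so the direct sum is     *)
(* expressed through finite families of distinct indices.                     *)
Definition cosemisimple (H : hopfPiCoalgebra) : Prop :=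
  exists (I : choiceType) (N : I -> forall a, {vspace H a}),
    [/\ forall i, simple_subcomodule (N i),
        forall a (x : H a), exists s : seq I, x \in (\sum_(i <- s) N i a)%VS &
        forall a (s : seq I) (x : I -> H a), uniq s ->
          (forall i, x i \in N i a) -> \sum_(i <- s) x i = 0 ->
          forall i, i \in s -> x i = 0].

Record piTrace (H : crossedPiCoalgebra) (tr : forall a, H a -> k) : Prop :=
  PiTrace {
  tr_linear : forall a, scalar (tr a);
  trC : forall a (x y : H a), tr a (x * y) = tr a (y * x);
  tr_antipode : forall a (x : H a), tr a^-1%g (antipode H a x) = tr a x;
  tr_phi : forall b a (x : H a), tr (cj b a) (phi H b a x) = tr a x
}.

End PiCoalgebra.

(* Main.v *)
(* If lam_1 = 0 then lam = 0. Otherwise lam_1 is a Frobenius form of H_1, so  *)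
(* there is a left integral L with lam_1(L) = 1, and L is two-sided by        *)
(* unimodularity. Pairing with Delta_{a,a^-1}(L) gives the Nakayama formula   *)
(* lam_a(x y) = lam_a(S^2(y) x) and the uniqueness of lam up to a scalar; in  *)
(* particular lam phi_g = c(g) lam with c(g) = lam_1(phi_g(L)), and each of   *)
(* the conditions (a)-(d) forces c = 1.                                       *)
(*   Since u_a x = S^2(phi_a(x)) u_a and phi_a is conjugation by the twist,   *)
(* G_a x = S^2(x) G_a, so the Nakayama formula makes lam(G_a _) symmetric.    *)
(* Invariance under S comes from lam_a(u_a y) = lam_{a^-1}(u_{a^-1} S(y)),    *)
(* read off from R Delta(L) = Delta^op(L) R.                                  *)

From Pilot Require Import Defs.
From HB Require Import structures.
From mathcomp Require Import all_boot all_order all_fingroup all_algebra.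

Set Implicit Arguments.
Unset Strict Implicit.
Unset Printing Implicit Defensive.

Import GRing.Theory VectorInternalTheory.
Local Open Scope ring_scope.

(** The legs L1, L2 of Delta_{a,b}(L), with a b = 1, act as dual bases for [lam] up to the antipode.
    [integral_mulr] and [integral_mull] carry a factor from one leg to the other at the price of an
    antipode, whence lam_a(L1 y) L2 = S(y) and lam_a(S(z) L1) L2 = z ([lam_integral_mulr],
    [lam_integral_mull]). By [integral_slice_eq0] a functional g on H_a is determined by g(L1) L2,
    so an identity of functionals need only be tested on that sum: this gives the Nakayama formula
    [lam_mulC] and the factor c(g) in [lam_cross]. The element L itself comes from
    [integral_exists], through the nondegeneracy [lam_antip_nondeg].

    On the quasitriangular side, [drinfeld_antip2] says that u_a implements S^2 phi_a, and
    [antip_drinfeld] recognises the sum of p S(q) over R_{a,b} as S(u_b). Pairing the exchange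
    relation for R and Delta(L) with [lam] then yields [lam_drinfeld]; there c = 1 enters, to
    discard a crossing under the integral. Adding the twist gives the three trace identities
    [ribbon_traceC], [ribbon_trace_antip] and [ribbon_trace_cross]. *)

Local Notation "\tsum_ ( p , q <- t ) E" := (tlift (fun p q => E) t)
  (at level 36, E at level 36, p name, q name, t at level 50,
   format "'[' \tsum_ ( p ,  q  <-  t ) '/  '  E ']'").

(** Sweedler sums: for t a comultiplication, p and q are its two legs. This variant fixes the types
    of the legs. *)
Local Notation "\tsum_ ( p : V , q : W <- t ) E" :=
  (tlift (fun (p : V) (q : W) => E) t)
  (at level 36, E at level 36, p name, q name, V at level 50, W at level 50,
   t at level 50, only parsing).

(** * Linearity and sums over tensors *)

Section Linearity.
Variables (k : fieldType) (V U W : lmodType k) (A : fdAlgType k).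

Lemma linear_scalE (f : V -> U) c x : linear f -> f (c *: x) = c *: f x.
Proof.
by move=> lf; have := lf (c - 1) x x; rewrite !scalerBl !scale1r !subrK.
Qed.

Lemma linear_id : linear (fun x : V => x).
Proof. by []. Qed.

Lemma linear_comp (F : U -> W) (f : V -> U) :
  linear F -> linear f -> linear (fun x => F (f x)).
Proof. by move=> lF lf c x y; rewrite lf lF. Qed.

Lemma linear_mull (f : V -> A) y : linear f -> linear (fun x => f x * y).
Proof. by move=> lf c u v; rewrite lf mulrDl fdscalerAl. Qed.

Lemma linear_mulr (f : V -> A) y : linear f -> linear (fun x => y * f x).
Proof. by move=> lf c u v; rewrite lf mulrDr fdscalerAr. Qed.

Lemma linear_scale (f : V -> U) (c : k) : linear f -> linear (fun x => c *: f x).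
Proof. by move=> lf d u v; rewrite lf scalerDr !scalerA mulrC. Qed.

Lemma linear_scaler (f : V -> k) (u : U) : scalar f -> linear (fun x => f x *: u).
Proof. by move=> lf d x y; rewrite lf scalerDl scalerA. Qed.

Lemma scalar_comp (F : U -> k) (f : V -> U) :
  scalar F -> linear f -> scalar (fun x => F (f x)).
Proof. by move=> lF lf c x y; rewrite lf lF. Qed.

Lemma linear_purel (X Y : vectType k) (f : V -> X) (y : Y) :
  linear f -> linear (fun x => pure (f x) y).
Proof. by move=> lf c u v; rewrite lf; apply: pure_linearl. Qed.

Lemma linear_purer (X Y : vectType k) (f : V -> Y) (x : X) :
  linear f -> linear (fun y => pure x (f y)).
Proof. by move=> lf c u v; rewrite lf; apply: pure_linearr. Qed.

Lemma linear_tlift_fun (X Y : vectType k) (b : V -> X -> Y -> U) (t : tens X Y) :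
  (forall p q, linear (fun x => b x p q)) -> linear (fun x => tlift (b x) t).
Proof.
move=> lb c u v; rewrite /tlift scaler_sumr -big_split; apply: eq_bigr => i _ /=.
rewrite scaler_sumr -big_split; apply: eq_bigr => j _ /=.
by rewrite lb scalerDr !scalerA mulrC.
Qed.

Lemma linear_tlift_arg (X Y : vectType k) (b : X -> Y -> U) (t : V -> tens X Y) :
  linear t -> linear (fun x => tlift b (t x)).
Proof. by move=> lt c u v; rewrite lt; apply: tlift_linear. Qed.

End Linearity.

(* Proves [linear] and [bilin] goals by structural descent on the function;   *)
(* hypotheses of that shape are used at the leaves.                           *)
Ltac lin :=
  lazymatch goal with
  | |- bilin _ => split; intro; lin
  | |- forall _, _ => intro; lin
  | |- GRing.linear_for _ _ => cbv beta; lin1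
  | |- _ => idtac
  end
with lin1 :=
  first
  [ assumption | solve [ auto 2 ]
  | exact: linearP | exact: scalarP
  | match goal with
    | |- GRing.linear_for _ (fun x => x) => apply: linear_id
    | |- GRing.linear_for _ (@pure _ _ _ _) => apply: pure_linearr
    | |- GRing.linear_for _ (@tlift _ _ _ _ _) => apply: tlift_linear
    | |- GRing.linear_for _ (@GRing.mul _ ?y) =>
        apply: (linear_mulr (f := fun x => x)); apply: linear_id
    | |- GRing.linear_for _ (fun x => @GRing.mul _ (@?f x) ?y) =>
        apply: linear_mull; lin
    | |- GRing.linear_for _ (fun x => @GRing.mul _ ?y (@?f x)) =>
        apply: linear_mulr; lin
    | |- GRing.linear_for _ (fun x => @GRing.scale _ _ ?c (@?f x)) =>
        apply: linear_scale; lin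
    | |- GRing.linear_for _ (fun x => @GRing.scale _ _ (@?c x) ?y) =>
        apply: linear_scaler; lin
    | |- GRing.linear_for _ (fun x => @pure _ _ _ (@?f x) ?y) =>
        apply: linear_purel; lin
    | |- GRing.linear_for _ (fun x => @pure _ _ _ ?y (@?f x)) =>
        apply: linear_purer; lin
    | |- GRing.linear_for _ (fun x => @tlift _ _ _ _ (@?f x) ?t) =>
        apply: linear_tlift_fun => ? ?; lin
    | |- GRing.linear_for _ (fun x => @tlift _ _ _ _ ?f (@?t x)) =>
        apply: linear_tlift_arg; lin
    | |- GRing.linear_for _ (fun x => ?F (@?f x)) =>
        first [ apply: (linear_comp (F := F)); [lin | lin]
              | apply: (scalar_comp (F := F)); [lin | lin] ]
    | |- GRing.linear_for _ (fun x => ?F (@?f x) ?y) =>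
        apply: (linear_comp (F := fun z => F z y)); [lin | lin]
    end ].

Section TensorSums.
Variable k : fieldType.
Implicit Types V W X Y : vectType k.

Lemma eq_tlift V W (U : lmodType k) (b b' : V -> W -> U) t :
  (forall p q, b p q = b' p q) -> tlift b t = tlift b' t.
Proof.
by move=> e; apply: eq_bigr => i _; apply: eq_bigr => j _; rewrite e.
Qed.

Lemma linear_tlift V W (U U' : lmodType k) (F : U -> U') (b : V -> W -> U) t :
  linear F -> F (tlift b t) = \tsum_(p, q <- t) F (b p q).
Proof.
move=> lF.
pose G : {linear U -> U'} := HB.pack F (GRing.isLinear.Build k U U' _ F lF).
rewrite -[F]/(G : U -> U') linear_sum; apply: eq_bigr => i _.
by rewrite linear_sum; apply: eq_bigr => j _; rewrite linearZ.
Qed.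

Lemma tlift_sum V W (U : lmodType k) (I : finType) (f : I -> V -> W -> U) t :
  \tsum_(p, q <- t) \sum_i f i p q = \sum_i tlift (f i) t.
Proof.
transitivity (\sum_i \sum_j \sum_l t i j *:
                f l (Defs.coord_basis i) (Defs.coord_basis j)).
  by apply: eq_bigr => i _; apply: eq_bigr => j _; rewrite scaler_sumr.
by rewrite (eq_bigr _ (fun i _ => exchange_big _ _ _ _ _ _)) exchange_big.
Qed.

Lemma exchange_tlift V W X Y (U : lmodType k) (b : V -> W -> X -> Y -> U) s t :
  \tsum_(p, q <- s) \tsum_(x, y <- t) b p q x y =
  \tsum_(x, y <- t) \tsum_(p, q <- s) b p q x y.
Proof.
have tlift_pairE (Z : lmodType k) (c : X -> Y -> Z) : tlift c t =
    \sum_ij t ij.1 ij.2 *: c (Defs.coord_basis ij.1) (Defs.coord_basis ij.2).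
  by rewrite /tlift pair_bigA.
rewrite [RHS]tlift_pairE.
transitivity (\tsum_(p, q <- s) \sum_ij t ij.1 ij.2 *:
  b p q (Defs.coord_basis ij.1) (Defs.coord_basis ij.2)).
  by apply: eq_tlift => p q; apply: tlift_pairE.
rewrite tlift_sum; apply: eq_bigr => ij _; rewrite (linear_tlift _ _ (F := _)) //.
by move=> c u v; rewrite scalerDr !scalerA mulrC.
Qed.

Lemma tlift_pure V W (t : tens V W) : tlift (@pure k V W) t = t.
Proof. by symmetry; apply: (tlift_uniq (f := idfun)). Qed.

Lemma tlift_mull V W (A : fdAlgType k) (b : V -> W -> A) t (y : A) :
  tlift b t * y = \tsum_(p, q <- t) (b p q * y).
Proof.
pose F (x : A) := x * y.
have lF : linear F by rewrite /F; lin.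
exact: (linear_tlift b t lF).
Qed.

Lemma tlift_mulr V W (A : fdAlgType k) (b : V -> W -> A) t (y : A) :
  y * tlift b t = \tsum_(p, q <- t) (y * b p q).
Proof.
have lF : linear (fun x : A => y * x) by lin.
exact: (linear_tlift b t lF).
Qed.

Lemma tlift_scale V W (U : lmodType k) (b : V -> W -> U) t c :
  c *: tlift b t = \tsum_(p, q <- t) (c *: b p q).
Proof.
have lF : linear (fun x : U => c *: x) by lin.
exact: (linear_tlift b t lF).
Qed.

Lemma tlift_tlift V W X Y (U : lmodType k) (f : X -> Y -> U)
    (b : V -> W -> tens X Y) t :
  tlift f (tlift b t) = \tsum_(p, q <- t) tlift f (b p q).
Proof. exact/linear_tlift/tlift_linear. Qed.

End TensorSums.

Section TensorProduct.
Variables (k : fieldType) (A B : fdAlgType k).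

Lemma pure11 : pure (1 : A) (1 : B) = 1 :> tens A B.
Proof. by []. Qed.

Lemma pureM (a a' : A) (b b' : B) :
  (pure a b : tens A B) * (pure a' b' : tens A B) = pure (a * a') (b * b').
Proof. exact: tens_mulE. Qed.

Lemma tlift_mul (U : lmodType k) (f : A -> B -> U) (s t : tens A B) : bilin f ->
  tlift f (s * t) =
  \tsum_(p : A, q : B <- s) \tsum_(p' : A, q' : B <- t) f (p * p') (q * q').
Proof.
move=> bf; rewrite [s * t]/(tens_mul s t) /tens_mul !tlift_tlift.
apply: eq_tlift => p q; rewrite !tlift_tlift; apply: eq_tlift => p' q'.
by rewrite tliftE.
Qed.

Lemma tens_tlift_mull (V W : vectType k) (b : V -> W -> tens A B) t (y : tens A B) :
  (tlift b t : tens A B) * y = \tsum_(p, q <- t) ((b p q : tens A B) * y : tens A B).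
Proof. exact: (linear_tlift b t (tens_mul_linl y)). Qed.

Lemma tens_tlift_mulr (V W : vectType k) (b : V -> W -> tens A B) t (y : tens A B) :
  y * (tlift b t : tens A B) = \tsum_(p, q <- t) (y * (b p q : tens A B) : tens A B).
Proof. exact: (linear_tlift b t (tens_mul_linr y)). Qed.

End TensorProduct.

(** * Linear algebra *)

Section LinearAlgebra.
Variable k : fieldType.
Implicit Types V W Y : vectType k.

Lemma scalar_lincomb (V : lmodType k) (f : V -> k) n (c : 'I_n -> k) x :
  scalar f -> f (\sum_i c i *: x i) = \sum_i c i * f (x i).
Proof.
move=> lf; pose g : {scalar V} := HB.pack f (GRing.isLinear.Build k V k _ f lf).
by rewrite -[f]/(g : V -> k) linear_sum; apply: eq_bigr => i _; rewrite linearZ.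
Qed.

Lemma scalar0 (V : lmodType k) (f : V -> k) : scalar f -> f 0 = 0.
Proof. by move=> lf; have := lf (-1) 0 0; rewrite scaler0 addr0 mulN1r addNr. Qed.

Lemma tlift_eq0 V W (U : lmodType k) (f : V -> W -> U) t :
  (forall p q, f p q = 0) -> tlift f t = 0.
Proof.
by move=> f0; apply: big1 => i _; apply: big1 => j _; rewrite f0 scaler0.
Qed.

Lemma tlift_sub V W (U : lmodType k) (f g : V -> W -> U) t :
  \tsum_(p, q <- t) (f p q - g p q) = tlift f t - tlift g t.
Proof.
rewrite /tlift -sumrB; apply: eq_bigr => i _; rewrite -sumrB.
by apply: eq_bigr => j _; rewrite scalerBr.
Qed.

Lemma scalar_eq0 V (x : V) : (forall f : V -> k, scalar f -> f x = 0) -> x = 0.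
Proof.
move=> f0; rewrite [x]coord_basisE; apply: big1 => i _.
by rewrite (f0 (fun x => v2r x 0 i)) ?scale0r // => c u v; rewrite linearP !mxE.
Qed.

Lemma scalar_neq0P V (f : V -> k) : scalar f ->
  (exists x, f x != 0) \/ (forall x, f x = 0).
Proof.
move=> lf; case: (boolP [exists i, f (@Defs.coord_basis _ V i) != 0]).
  by case/existsP=> i fi; left; exists (Defs.coord_basis i).
rewrite negb_exists => /forallP f0; right => x.
rewrite [x]coord_basisE scalar_lincomb // big1 // => i _.
by have := f0 i; rewrite negbK => /eqP ->; rewrite mulr0.
Qed.

Lemma limg_linear_inj V W (f : {linear V -> W}) :
  (forall x, f x = 0 -> x = 0) -> \dim (limg (linfun f)) = dim V.
Proof.
move=> f0; rewrite limg_dim_eq ?dimvf //.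
apply/eqP; rewrite -subv0; apply/subvP=> x.
by rewrite memv_cap memv_ker lfunE memv0 => /andP[_ /eqP/f0->].
Qed.

Lemma linear_inj_surj V W (f : {linear V -> W}) :
    (forall x, f x = 0 -> x = 0) -> (dim W <= dim V)%N ->
  forall y, exists x, f x = y.
Proof.
move=> f0 dVW y; have : y \in limg (linfun f).
  suff -> : limg (linfun f) = fullv by exact: memvf.
  by apply/eqP; rewrite eqEdim subvf limg_linear_inj // dimvf.
by case/memv_imgP=> x _ ->; exists x; rewrite lfunE.
Qed.

Lemma linear_inj_dim V W (f : {linear V -> W}) :
  (forall x, f x = 0 -> x = 0) -> (dim V <= dim W)%N.
Proof. by move/limg_linear_inj <-; rewrite -(dimvf W) dimvS ?subvf. Qed.

(** The Gram matrix is square with trivial left kernel, hence invertible; its inverse also produces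
    the vector representing [f]. *)
Lemma nondegenerate_right V (b : V -> V -> k) :
    (forall v, scalar (b v)) -> (forall w, scalar (b^~ w)) ->
    (forall v, (forall w, b v w = 0) -> v = 0) ->
  (forall w, (forall v, b v w = 0) -> w = 0) /\
  (forall f : V -> k, scalar f -> exists w, forall v, b v w = f v).
Proof.
move=> br bl b0.
pose M := \matrix_(i, j) b (@Defs.coord_basis _ V i) (Defs.coord_basis j).
have bE v w : b v w = (v2r v *m M *m (v2r w)^T) 0 0.
  rewrite {1}[v]coord_basisE (scalar_lincomb _ _ (bl w)) -mulmxA mxE.
  apply: eq_bigr => i _; congr (_ * _).
  rewrite {1}[w]coord_basisE (scalar_lincomb _ _ (br _)) mxE.
  by apply: eq_bigr => j _; rewrite !mxE mulrC.
have Mu : M \in unitmx.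
  rewrite -row_free_unit; apply: inj_row_free => v vM.
  rewrite -[v]r2vK (b0 (r2v v)) ?linear0 // => w.
  by rewrite bE r2vK vM mul0mx mxE.
split=> [w bw|f lf].
  suff w0 : M *m (v2r w)^T = 0.
    rewrite -[w]v2rK -[v2r w]trmxK -[(v2r w)^T](mulKmx Mu) w0 mulmx0 trmx0.
    exact: linear0.
  apply/matrixP=> i j; have := bw (Defs.coord_basis i).
  by rewrite bE /Defs.coord_basis r2vK -mulmxA -rowE mxE (ord1 j) => ->; rewrite mxE.
pose c := \col_i f (@Defs.coord_basis _ V i).
exists (r2v (invmx M *m c)^T) => v.
rewrite bE r2vK trmxK mulmxA mulmxK // {2}[v]coord_basisE scalar_lincomb // mxE.
by apply: eq_bigr => i _; rewrite mxE.
Qed.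

(** The argument of [b] may depend on the other leg: expand [L p] in coordinates and use the
    hypothesis at each basis vector of [Y]. *)
Lemma tlift_scaler_eq0 V W Y (U : lmodType k) (t : tens V W) (b : W -> Y -> k)
    (L : V -> Y) (u : U) : (forall q, scalar (b q)) -> linear L ->
  (forall y, \tsum_(p, q <- t) (b q y *: p) = 0) ->
  \tsum_(p, q <- t) (b q (L p) *: u) = 0.
Proof.
move=> lb lL b0.
pose F i p := v2r (L p) 0 i *: u.
have lF i : linear (F i).
  by move=> c x y; rewrite /F lL linearP !mxE scalerDl scalerA.
transitivity (\tsum_(p, q <- t) \sum_i F i (b q (Defs.coord_basis i) *: p)).
  apply: eq_tlift => p q.
  rewrite {1}[L p]coord_basisE (scalar_lincomb _ _ (lb q)) scaler_suml.
  by apply: eq_bigr => i _; rewrite linear_scalE // /F scalerA mulrC.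
rewrite tlift_sum big1 // => i _.
rewrite -(linear_tlift _ _ (lF i)) b0; have := linear_scalE 0 0 (lF i).
by rewrite !scale0r.
Qed.

Lemma slice_row V W (t : tens V W) (l : V -> k) :
  v2r (\tsum_(p, q <- t) (l p *: q)) = \row_i l (Defs.coord_basis i) *m t.
Proof.
rewrite /tlift linear_sum; apply/rowP=> j; rewrite summxE !mxE.
apply: eq_bigr => i _; rewrite /= linear_sum summxE (bigD1 j) //= big1.
  by rewrite addr0 !linearZ /= !mxE /Defs.coord_basis r2vK !mxE !eqxx mulr1 mulrC.
move=> j' j'j; rewrite !linearZ /= !mxE /Defs.coord_basis r2vK !mxE /= [j == j']eq_sym.
by rewrite (negPf j'j) ?andbF !mulr0.
Qed.

(** Contracting the first leg is multiplication of a row by the matrix [t]. Surjectivity gives full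
    rank, and for a square matrix this is injectivity. *)
Lemma tens_slice_eq0 V W (t : tens V W) (g : V -> k) : dim V = dim W ->
    (forall z, exists2 l : V -> k, scalar l & \tsum_(p, q <- t) (l p *: q) = z) ->
    scalar g -> \tsum_(p, q <- t) (g p *: q) = 0 ->
  forall x, g x = 0.
Proof.
move=> eVW surj lg g0.
have t_free : row_free t.
  have /eqP rt : row_full t.
    rewrite -sub1mx; apply/row_subP=> i; apply/submxP.
    have [l _ e] := surj (r2v (row i 1%:M)).
    by exists (\row_i l (Defs.coord_basis i)); rewrite -slice_row e r2vK.
  by rewrite /row_free rt eVW.
have r0 : \row_i g (Defs.coord_basis i) = 0.
  by apply: (row_free_inj t_free); rewrite -slice_row g0 mul0mx linear0.
move=> x; rewrite [x]coord_basisE scalar_lincomb // big1 // => i _.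
by have /rowP/(_ i) := r0; rewrite !mxE => ->; rewrite mulr0.
Qed.

Lemma kernel_vspace V (f : V -> k) : scalar f ->
  {K : {vspace V} | forall x, (x \in K) = (f x == 0)}.
Proof.
move=> lf.
pose g : {linear V -> k^o} := HB.pack f (GRing.isLinear.Build k V k^o _ f lf).
by exists (lker (linfun g)) => x; rewrite memv_ker lfunE.
Qed.

(** The second leg is contracted with the [j]-th coordinate form. *)
Definition tens_slice V W (t : tens V W) j : V := \sum_i t i j *: Defs.coord_basis i.

Lemma tens_slice_linear V W j : linear (@tens_slice V W ^~ j).
Proof.
move=> c s t; rewrite /tens_slice scaler_sumr -big_split; apply: eq_bigr => i _.
by rewrite !mxE scalerDl scalerA.
Qed.

Lemma tens_sliceE V W (t : tens V W) :
  t = \sum_j pure (tens_slice t j) (Defs.coord_basis j).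
Proof.
rewrite {1}[t]tens_sumE exchange_big; apply: eq_bigr => j _.
pose g : {linear V -> tens V W} := HB.pack (fun v => pure v (Defs.coord_basis j))
  (GRing.isLinear.Build k V (tens V W) _ _ (pure_linearl (Defs.coord_basis j))).
by rewrite -[RHS]/(g (tens_slice t j)) linear_sum.
Qed.

Lemma tens_slice_eq V W (t : tens V W) : (forall j, tens_slice t j = 0) -> t = 0.
Proof.
move=> t0; rewrite [t]tens_sliceE big1 // => j _; rewrite t0.
by apply/matrixP=> i l; rewrite !mxE linear0 mxE mul0r.
Qed.

Lemma tens_slice_scalar V W (t : tens V W) (f : V -> k) j : scalar f ->
  \tsum_(p, q <- t) (f p *: q) = 0 -> f (tens_slice t j) = 0.
Proof.
move=> lf t0; have /rowP/(_ j) := congr1 v2r t0.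
rewrite slice_row linear0 !mxE => E; rewrite -[RHS]E scalar_lincomb //.
by apply: eq_bigr => i _; rewrite mxE mulrC.
Qed.

Lemma pure_tensv V W (M : {vspace V}) (N : {vspace W}) v w :
  v \in M -> w \in N -> pure v w \in tensv M N.
Proof.
move=> /coord_vbasis-> /coord_vbasis->.
rewrite (linear_lincomb _ _ (pure_linearl _)) memv_suml // => i _; apply: memvZ.
rewrite (linear_lincomb _ _ (pure_linearr _)) memv_suml // => j _; apply: memvZ.
by apply/memv_span/allpairs_f; apply/mem_nth; rewrite size_tuple.
Qed.

(** Reduces the subcomodule condition to membership of vectors, so that it can be intersected with a
    kernel. *)
Lemma tensv_fullP V W (M : {vspace V}) (t : tens V W) :
  t \in tensv M fullv <-> forall j, tens_slice t j \in M.
Proof.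
split=> [|tM]; last first.
  rewrite [t]tens_sliceE memv_suml // => j _.
  by apply: pure_tensv => //; apply: memvf.
move=> tM j; pose g : {linear tens V W -> V} := HB.pack (@tens_slice V W ^~ j)
  (GRing.isLinear.Build k (tens V W) V _ _ (@tens_slice_linear V W j)).
have gE s : tens_slice s j = linfun g s by rewrite lfunE.
rewrite gE memv_preim.
apply: subvP tM; apply/span_subvP=> _ /allpairsP[[v w] /= [vM _ ->]].
rewrite -memv_preim -gE /tens_slice.
rewrite (eq_bigr (fun i => (v2r w 0 j) *: (v2r v 0 i *: Defs.coord_basis i))).
  by rewrite -scaler_sumr -coord_basisE memvZ // vbasis_mem.
by move=> i _; rewrite mxE mulrC scalerA.
Qed.

End LinearAlgebra.

(** * Hopf group-coalgebras *)

Section GroupInverses.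
Variables (pi : groupType) (a b : pi) (ab : (a * b = 1)%g).

Lemma invg_eq : a^-1%g = b.
Proof. by rewrite -[b](mulKg a) ab mulg1. Qed.

Lemma mulg_eq1C : (b * a = 1)%g.
Proof. by rewrite -invg_eq mulVg. Qed.

End GroupInverses.

Section Recast.
Variables (k : fieldType) (pi : groupType) (H : hopfPiCoalgebra k pi).
Implicit Types a b c p q r : pi.

(* A total version of [hcast], carrying no equality proof; its value is the   *)
(* junk 0 when the two indices differ.                                        *)
Definition recast a b (x : H a) : H b :=
  if @eqP _ a b is ReflectT e then hcast e x else 0.
Arguments recast {a} b x.

Lemma recast_id a (x : H a) : recast a x = x.
Proof. by rewrite /recast; case: eqP => // e; rewrite (eq_axiomK e). Qed.

Lemma recastE a b (e : a = b) (x : H a) : hcast e x = recast b x.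
Proof. by case: b / e; rewrite recast_id. Qed.

Lemma recast_recast a b c (x : H a) :
  a = b \/ b = c -> recast c (recast b x) = recast c x.
Proof. by case=> e; [move: x; case: b / e => x | case: c / e]; rewrite !recast_id. Qed.

Fact recast_linear a b : linear (@recast a b).
Proof.
rewrite /recast => c x y; case: eqP => [e|_]; last by rewrite scaler0 addr0.
by case: b / e.
Qed.
HB.instance Definition _ a b :=
  GRing.isLinear.Build k (H a) (H b) _ (@recast a b) (@recast_linear a b).

Lemma recastM a b (x y : H a) : a = b -> recast b (x * y) = recast b x * recast b y.
Proof. by move=> e; case: b / e; rewrite !recast_id. Qed.

Lemma recast1 a b : a = b -> recast b (1 : H a) = 1.
Proof. by move=> e; case: b / e; rewrite !recast_id. Qed.

(** Building [recast] into the structure maps, here and in [antip] and [cross], replaces casts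
    inside formulas by group equations as side conditions. *)
Definition comul a b c (x : H c) : tens (H a) (H b) := Delta H a b (recast (a * b)%g x).

Fact comul_linear a b c : linear (@comul a b c).
Proof. by move=> d x y; rewrite /comul !linearP. Qed.
HB.instance Definition _ a b c := GRing.isLinear.Build k (H c) (tens (H a) (H b)) _
  (@comul a b c) (@comul_linear a b c).

Definition antip a b (x : H a) : H b := recast b (antipode H a x).

Fact antip_linear a b : linear (@antip a b).
Proof. by move=> d x y; rewrite /antip !linearP. Qed.
HB.instance Definition _ a b := GRing.isLinear.Build k (H a) (H b) _
  (@antip a b) (@antip_linear a b).

End Recast.
Arguments recast {k pi H a} b x.
Arguments comul {k pi H} a b {c} x.
Arguments antip {k pi H a} b x.

Section HopfCalculus.
Variables (k : fieldType) (pi : groupType) (H : hopfPiCoalgebra k pi).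
Implicit Types a b c p q r : pi.

Lemma comul_coassoc a b c p q r (x : H r) (U : lmodType k)
    (f : H a -> H b -> H c -> U) :
    p = (a * b)%g -> q = (b * c)%g -> r = (a * b * c)%g ->
    (forall v w, linear (fun u => f u v w)) ->
    (forall u w, linear (fun v => f u v w)) ->
    (forall u v, linear (f u v)) ->
  \tsum_(y, w <- comul p c x) \tsum_(u, v <- comul a b y) f u v w =
  \tsum_(u, y <- comul a q x) \tsum_(v, w <- comul b c y) f u v w.
Proof.
move=> ep eq er l1 l2 l3; subst p q r.
rewrite /comul recast_id -(recastE (esym (mulgA a b c))).
have := coassoc (hopf_coalgebra H) x.
rewrite /tassoc /tmap !tlift_tlift => /(congr1 (tlift (fun u => tlift (f u)))).
rewrite !tlift_tlift.
have lf u : linear (fun t => tlift (f u) t) by lin.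
have bf u : bilin (f u) by split=> ?; auto.
have l4 t : linear (fun u => tlift (f u) t) by lin; auto.
have bF : bilin (fun u => tlift (f u)) by split.
move=> E; transitivity
  (\tsum_(y, w <- Delta H (a * b)%g c x) \tsum_(u, v <- Delta H a b y) f u v w).
  by apply: eq_tlift => y w; rewrite recast_id.
transitivity (\tsum_(u, y <- Delta H a (b * c)%g (hcast (esym (mulgA a b c)) x))
  \tsum_(v, w <- Delta H b c y) f u v w); last first.
  by apply: eq_tlift => y w; rewrite recast_id.
move: E; congr (_ = _); apply: eq_tlift => u y.
  rewrite tliftE; last by lin.
  rewrite !tlift_tlift; apply: eq_tlift => v w.
  by rewrite tliftE ?tliftE //; lin.
by rewrite tliftE // tliftE // /idfun; lin.
Qed.

Lemma comul_counitl a (x : H a) (U : lmodType k) (f : H a -> U) :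
  linear f -> \tsum_(p, q <- comul 1%g a x) (eps H p *: f q) = f x.
Proof.
move=> lf; rewrite -[in RHS](counitl (hopf_coalgebra H) x) /comul.
rewrite -(recastE (esym (mul1g a))) (linear_tlift _ _ lf); apply: eq_tlift => p q.
by rewrite linear_scalE.
Qed.

Lemma comul_counitr a (x : H a) (U : lmodType k) (f : H a -> U) :
  linear f -> \tsum_(p, q <- comul a 1%g x) (eps H q *: f p) = f x.
Proof.
move=> lf; rewrite -[in RHS](counitr (hopf_coalgebra H) x) /comul.
rewrite -(recastE (esym (mulg1 a))) (linear_tlift _ _ lf); apply: eq_tlift => p q.
by rewrite linear_scalE.
Qed.

Lemma comul1 a b c : c = (a * b)%g -> comul a b (1 : H c) = pure (1 : H a) (1 : H b).
Proof. by move=> e; rewrite /comul recast1 //; case: (Delta_morph H a b). Qed.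

Lemma comulM a b c (x y : H c) (U : lmodType k) (f : H a -> H b -> U) :
    c = (a * b)%g -> bilin f ->
  tlift f (comul a b (x * y)) =
  \tsum_(p : H a, q : H b <- comul a b x)
    \tsum_(p' : H a, q' : H b <- comul a b y) f (p * p') (q * q').
Proof.
move=> e bf; rewrite /comul recastM //.
have [_ ->] := Delta_morph H a b.
by rewrite tlift_mul.
Qed.

Lemma eps1 : eps H (1 : H 1%g) = 1.
Proof. by case: (eps_morph H). Qed.

Lemma epsM (x y : H 1%g) : eps H (x * y) = eps H x * eps H y.
Proof. by have [_ ->] := eps_morph H. Qed.

Lemma antipl a b (x : H 1%g) (U : lmodType k) (f : H b -> U) :
    (a * b = 1)%g -> linear f ->
  \tsum_(p : H a, q : H b <- comul a b x) f (antip b p * q) = eps H x *: f (1 : H _).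
Proof.
move=> ab lf; have ea : a = b^-1%g by rewrite -[a](mulgK b) ab mul1g.
subst a; rewrite -(linear_scalE _ _ lf) -antipodel (linear_tlift _ _ lf).
rewrite /comul -(recastE (esym (mulVg b))); apply: eq_tlift => p q.
by rewrite /antip -(recastE (invgK b)).
Qed.

Lemma antipr a b (x : H 1%g) (U : lmodType k) (f : H a -> U) :
    (a * b = 1)%g -> linear f ->
  \tsum_(p : H a, q : H b <- comul a b x) f (p * antip a q) = eps H x *: f (1 : H _).
Proof.
move=> ab lf; have eb : b = a^-1%g by rewrite -[b](mulKg a) ab mulg1.
subst b; rewrite -(linear_scalE _ _ lf) -antipoder (linear_tlift _ _ lf).
rewrite /comul -(recastE (esym (mulgV a))); apply: eq_tlift => p q.
by rewrite /antip -(recastE (invgK a)).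
Qed.

End HopfCalculus.

Section Antipode.
Variables (k : fieldType) (pi : groupType) (H : hopfPiCoalgebra k pi).
Variables (a b : pi) (ab : (a * b = 1)%g).

Let ba : (b * a = 1)%g.
Proof. exact: mulg_eq1C. Qed.

(** Iterated comultiplication H_a -> H_a (x) H_b (x) H_a; the middle leg, of inverse index, can
    cancel against the antipode of either neighbour. *)
Definition comul3 (x : H a) (U : lmodType k) (f : H a -> H b -> H a -> U) : U :=
  \tsum_(y, w <- comul 1%g a x) \tsum_(u, v <- comul a b y) f u v w.

Lemma eq_comul3 (x : H a) (U : lmodType k) (f g : H a -> H b -> H a -> U) :
  (forall u v w, f u v w = g u v w) -> comul3 x f = comul3 x g.
Proof. by move=> e; apply: eq_tlift => y w; apply: eq_tlift. Qed.

Lemma comul3_assoc (x : H a) (U : lmodType k) (f : H a -> H b -> H a -> U) :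
    (forall v w, linear (fun u => f u v w)) ->
    (forall u w, linear (fun v => f u v w)) ->
    (forall u v, linear (f u v)) ->
  comul3 x f = \tsum_(u, y <- comul a 1%g x) \tsum_(v, w <- comul b a y) f u v w.
Proof. by move=> l1 l2 l3; apply: comul_coassoc; rewrite ?ab ?ba ?mul1g. Qed.

Lemma comul3_antipl (x : H a) (U : lmodType k) (f : H b -> H a -> U) : bilin f ->
  comul3 x (fun u v w => f (antip b u * v) w) = f 1 x.
Proof.
move=> [l1 l2]; rewrite -(comul_counitl x (l1 1)); apply: eq_tlift => y w.
by rewrite (antipl _ (f := f^~ w)).
Qed.

Lemma comul3_antipr (x : H a) (U : lmodType k) (f : H a -> H b -> U) : bilin f ->
  comul3 x (fun u v w => f u (v * antip b w)) = f x 1.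
Proof.
move=> [l1 l2]; rewrite comul3_assoc; try by lin.
rewrite -(comul_counitr x (l2 1)); apply: eq_tlift => u y.
by rewrite (antipr _ (f := f u)).
Qed.

Lemma antip1 : antip b (1 : H a) = 1.
Proof.
have := @antipl k pi H a b 1 (H b) id ab (fun _ _ _ => erefl).
rewrite comul1 // eps1 scale1r tliftE ?mulr1 //; lin.
Qed.

(** Uniqueness of convolution inverses: in S(x1 y1) x2 y2 S(y3) S(x3) the last four factors collapse
    to 1, leaving S(x y), while the first three collapse to counits, leaving S(y) S(x). *)
Lemma antipM (x y : H a) : antip b (x * y) = antip b y * antip b x.
Proof.
pose F (x1 y1 : H a) (x2 y2 : H b) (x3 y3 : H a) : H b :=
  antip b (x1 * y1) * (x2 * y2) * (antip b y3 * antip b x3).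
transitivity (comul3 x (fun x1 x2 x3 =>
  comul3 y (fun y1 y2 y3 => F x1 y1 x2 y2 x3 y3))).
  rewrite -[LHS]mulr1.
  have bS : bilin (fun (u : H a) (v : H b) => antip b (u * y) * v) by lin.
  rewrite -(comul3_antipr x bS); apply: eq_comul3 => x1 x2 x3.
  pose f (y1 : H a) (r : H b) := antip b (x1 * y1) * (x2 * r * antip b x3).
  have bf : bilin f by rewrite /f; lin.
  have := comul3_antipr y bf; rewrite {2}/f mulr1 => <-.
  by apply: eq_comul3 => y1 y2 y3; rewrite /f /F !mulrA.
transitivity (\tsum_(x0, x3 <- comul 1%g a x) \tsum_(y0, y3 <- comul 1%g a y)
   (eps H x0 *: (eps H y0 *: (antip b y3 * antip b x3)))); last first.
  have lx : linear (fun x3 : H a => antip b y * antip b x3) by lin.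
  rewrite -(comul_counitl x lx); apply: eq_tlift => x0 x3.
  have ly : linear (fun y3 : H a => antip b y3 * antip b x3) by lin.
  by rewrite -(comul_counitl y ly) tlift_scale.
rewrite /comul3; apply: eq_tlift => x0 x3.
rewrite [LHS]exchange_tlift; apply: eq_tlift => y0 y3.
pose f (u : H b) := u * (antip b y3 * antip b x3).
have lf : linear f by rewrite /f; lin.
have := antipl (x0 * y0) ab lf; rewrite {2}/f mul1r epsM -scalerA => <-.
by rewrite comulM ?ab //; rewrite /f; lin.
Qed.

End Antipode.
Arguments antip1 {k pi} H {a b} ab.
Arguments comul3 {k pi H a} b x {U} f.

Section ComulAntip.
Variables (k : fieldType) (pi : groupType) (H : hopfPiCoalgebra k pi).
Local Notation D := (comul (H := H) 1%g 1%g (c := 1%g)).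
Local Notation S := (antip (H := H) (a := 1%g) 1%g).

Lemma eps_antip (x : H 1%g) : eps H (S x) = eps H x.
Proof.
have e11 : (1 * 1 = 1 :> pi)%g by rewrite mulg1.
pose f (z : H 1%g) := eps H z *: (1 : H 1%g).
have lf : linear f by rewrite /f; lin.
have lfS : linear (fun z => f (S z)) by lin.
suff: f (S x) = f x.
  by move/(congr1 (eps H)); rewrite /f !linearZ eps1 /= !mulr1.
have := antipl x e11 lf; rewrite {2}/f eps1 scale1r -/(f x) => <-.
rewrite -(comul_counitr x lfS); apply: eq_tlift => p q.
by rewrite /f epsM mulrC scalerA.
Qed.

(** Both sides are convolution inverses of the comultiplication, on the left and on the right;
    Delta(S(x1)) Delta(x2) G(x3) is collapsed from either end. *)
Lemma comul_antip (x : H 1%g) :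
  D (S x) = \tsum_(p, q <- D x) pure (S q) (S p).
Proof.
have e1 : (1 * 1 = 1 :> pi)%g by rewrite mulg1.
pose G (w : H 1%g) := \tsum_(p, q <- D w) pure (S q) (S p).
have lG : linear G by rewrite /G; lin.
transitivity (comul3 1%g x (fun x1 x2 w => D (S x1) * (D x2 * G w))); last first.
  have bf : bilin (fun (u w : H 1%g) => D u * G w) by lin.
  transitivity (comul3 1%g x (fun x1 x2 w => D (S x1 * x2) * G w)).
    apply: eq_comul3 => u v w; rewrite mulrA; congr (_ * _).
    by rewrite -[RHS]tlift_pure comulM ?mulg1 //; lin.
  by rewrite (comul3_antipl e1 x bf) comul1 ?mulg1 // pure11 mul1r.
transitivity (\tsum_(u, y <- D x) (eps H y *: D (S u))).
  by rewrite comul_counitr //; lin.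
rewrite comul3_assoc; try by lin.
apply: eq_tlift => u y; rewrite -tlift_mulr.
suff -> : \tsum_(p, q <- D y) (D p * G q) = eps H y *: (1 : tens (H 1%g) (H 1%g)).
  by rewrite -fdscalerAr mulr1.
pose F (v1 v2 w : H 1%g) := \tsum_(w1 : H 1%g, w2 : H 1%g <- D w)
  (pure (v1 * S w2) (v2 * S w1) : tens (H 1%g) (H 1%g)).
transitivity (\tsum_(p, w <- D y) \tsum_(v1, v2 <- D p) F v1 v2 w).
  apply: eq_tlift => p w; rewrite -[LHS]tlift_pure tlift_mul; last by lin.
  apply: eq_tlift => v1 v2; rewrite tlift_tlift; apply: eq_tlift => w1 w2.
  by rewrite tliftE //; lin.
rewrite (comul_coassoc (q := 1%g)) ?mulg1 //; try by rewrite /F; lin.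
have l1 : linear (fun z : H 1%g => pure (z : H 1%g) (1 : H 1%g)) by lin.
rewrite -pure11 -(antipr y e1 l1); apply: eq_tlift => v1 y'.
rewrite /F.
have l2 : linear (fun z : H 1%g => pure (v1 * S z : H 1%g) (1 : H 1%g)) by lin.
rewrite -(comul_counitl y' l2).
pose F' (v2 w1 w2 : H 1%g) := pure (v1 * S w2) (v2 * S w1).
transitivity (\tsum_(z, w2 <- D y') \tsum_(v2, w1 <- D z) F' v2 w1 w2).
  by symmetry; apply: comul_coassoc; rewrite ?mulg1 //; rewrite /F'; lin.
apply: eq_tlift => z w2; rewrite /F'.
have l3 : linear (fun q : H 1%g => pure (v1 * S w2) q) by lin.
by rewrite (antipr z e1 l3).
Qed.
End ComulAntip.

Section Crossing.
Variables (k : fieldType) (pi : groupType) (H : crossedPiCoalgebra k pi).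
Implicit Types a b c d g h : pi.

Definition cross g a c (x : H a) : H c := recast c (phi H g a x).

Fact cross_linear g a c : linear (@cross g a c).
Proof. by move=> d x y; rewrite /cross !linearP. Qed.
HB.instance Definition _ g a c := GRing.isLinear.Build k (H a) (H c) _
  (@cross g a c) (@cross_linear g a c).
End Crossing.
Arguments cross {k pi H} g {a} c x.

Section CrossingCalculus.
Variables (k : fieldType) (pi : groupType) (H : crossedPiCoalgebra k pi).
Implicit Types a b c d g h : pi.

Lemma crossM g a c (x y : H a) : c = cj g a ->
  cross g c (x * y) = cross g c x * cross g c y.
Proof.
by move=> e; rewrite /cross -recastM //; case: (phi_morph H g a) => _ ->.
Qed.

Lemma cross1 g a c : c = cj g a -> cross g c (1 : H a) = 1.
Proof.
by move=> e; rewrite /cross; case: (phi_morph H g a) => -> _; rewrite recast1.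
Qed.

Lemma eps_cross g (x : H 1%g) : eps H (cross g 1%g x) = eps H x.
Proof. by rewrite /cross -(recastE (cj1 g)) phi_eps. Qed.

Lemma cross_cross g h a c d (x : H a) : c = cj h a -> d = cj g c ->
  cross g d (cross h c x) = cross (g * h)%g d x.
Proof.
move=> ec ed; subst c d; rewrite /cross !recast_id phi_mul (recastE (cj_mul g h a)).
by rewrite recast_recast; [rewrite recast_id | left; apply: cj_mul].
Qed.

(** By multiplicativity phi_1 is idempotent, and an injective idempotent map is the identity. *)
Lemma cross_id a (x : H a) : cross 1%g a x = x.
Proof.
have e : a = cj 1%g a by rewrite mul1g invg1 mulg1.
have K : cross 1%g a (cross 1%g a x) = cross 1%g a x by rewrite cross_cross // mulg1.
have [psi phiK _] := phi_bij H 1%g a.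
suff inj : injective (@cross k pi H 1%g a a) by apply: inj.
apply: (can_inj (g := fun y => psi (recast _ y))) => y.
by rewrite /cross recast_recast; [rewrite recast_id | left].
Qed.

Lemma crossK g a c (x : H a) : c = cj g a -> cross g^-1%g a (cross g c x) = x.
Proof.
move=> e; rewrite cross_cross // ?e ?cjVK // mulVg; exact: cross_id.
Qed.

Lemma comul_cross g a b c a' b' c' (x : H c) (U : lmodType k) (f : H a' -> H b' -> U) :
    a' = cj g a -> b' = cj g b -> c = (a * b)%g -> c' = (a' * b')%g -> bilin f ->
  tlift f (comul a' b' (cross g c' x)) =
  \tsum_(p, q <- comul a b x) f (cross g a' p) (cross g b' q).
Proof.
move=> ea eb ec ec' bf; subst a' b' c c'.
rewrite /cross /comul recast_recast ?recast_id; last by right.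
rewrite -(recastE (cjM g a b)) -phi_Delta /tmap tlift_tlift.
by apply: eq_tlift => p q; rewrite tliftE // !recast_id.
Qed.

(** Again uniqueness of convolution inverses: S(phi(x1)) phi(x2) phi(S(x3)) is collapsed from either
    end. *)
Lemma antip_cross g a b a' b' (x : H a) :
    (a * b = 1)%g -> a' = cj g a -> b' = cj g b ->
  antip b' (cross g a' x) = cross g b' (antip b x).
Proof.
move=> ab ea eb.
have ab' : (a' * b' = 1)%g by rewrite ea eb -cjM ab cj1.
pose f (u : H a) (v : H b) := antip b' (cross g a' u) * cross g b' v.
have bf : bilin f by rewrite /f; lin.
transitivity (comul3 b x (fun u v w => f u (v * antip b w))).
  by rewrite (comul3_antipr ab x bf) /f cross1 // mulr1.
have lx : linear (fun z : H a => cross g b' (antip b z)) by lin.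
rewrite -(comul_counitl x lx); apply: eq_tlift => y w.
pose h (u : H b') := u * cross g b' (antip b w).
have lh : linear h by rewrite /h; lin.
have := antipl (cross g 1%g y) ab' lh; rewrite {2}/h mul1r eps_cross => <-.
rewrite (comul_cross (g := g) (a := a) (b := b)) // /h; last by lin.
by apply: eq_tlift => u v; rewrite /f crossM // mulrA.
Qed.

End CrossingCalculus.

(** * Integrals *)

Section Integral.
Variables (k : fieldType) (pi : groupType) (H : hopfPiCoalgebra k pi).
Variable lam : forall a : pi, {scalar H a}.
Hypothesis lam_int : right_piIntegral lam.
Implicit Types a b c : pi.

Lemma lam_comul a b c (x : H c) (U : lmodType k) (f : H b -> U) :
    c = (a * b)%g -> linear f ->
  \tsum_(p, q <- comul a b x) (lam a p *: f q) = lam c x *: f (1 : H b).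
Proof.
move=> e lf; subst c; rewrite /comul recast_id -(linear_scalE _ _ lf) -lam_int.
by rewrite (linear_tlift _ _ lf); apply: eq_tlift => p q; rewrite linear_scalE.
Qed.

Lemma lam_eq0 : (forall x, lam 1%g x = 0) -> forall a x, lam a x = 0.
Proof.
move=> lam0 a x; have := lam_comul x (esym (mul1g a)) (@linear_id k (H a)).
rewrite tlift_eq0 => [|p q]; last by rewrite lam0 scale0r.
(* The remaining case is 1 = 0 in [H a], the zero algebra, where x = 0. *)
move/esym/eqP; rewrite scaler_eq0 => /orP[/eqP-> //|/eqP e1].
by rewrite -[x]mulr1 e1 mulr0 linear0.
Qed.

Local Notation S := (antip (H := H) (a := 1%g) 1%g).
Local Notation D := (comul (H := H) 1%g 1%g (c := 1%g)).
Let e11 : (1 * 1 = 1 :> pi)%g. Proof. exact: mulg1. Qed.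

(** Lets scalar identities be proved as identities in [H 1], since Sweedler sums take values in
    modules. *)
Lemma scale1_inj (c d : k) : c *: (1 : H 1%g) = d *: (1 : H 1%g) -> c = d.
Proof. by move/(congr1 (eps H)); rewrite !linearZ /= eps1 !mulr1. Qed.

(** The integral property at S(h2) y writes the left side as lam(S(h3) y1) h1 S(h2) y2, where h1
    S(h2) cancels. *)
Lemma lam_antip_comul (h y : H 1%g) :
  \tsum_(p, q <- D h) (lam 1%g (S q * y) *: p) =
  \tsum_(y1 : H 1%g, y2 : H 1%g <- D y) (lam 1%g (S h * y1) *: y2).
Proof.
pose F (p q1 q2 : H 1%g) := \tsum_(y1 : H 1%g, y2 : H 1%g <- D y)
  (lam 1%g (S q2 * y1) *: (p * (S q1 * y2))).
have lF1 q1 q2 : linear (fun p => F p q1 q2) by rewrite /F; lin.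
have lF2 p q2 : linear (fun q1 => F p q1 q2) by rewrite /F; lin.
have lF3 p q1 : linear (F p q1) by rewrite /F; lin.
transitivity (\tsum_(p, q <- D h) \tsum_(q1, q2 <- D q) F p q1 q2).
  apply: eq_tlift => p q.
  have lp : linear (fun z : H 1%g => p * z) by lin.
  rewrite -{1}[p]mulr1 -(lam_comul (S q * y) (esym e11) lp).
  rewrite comulM ?e11 //; last by lin.
  by rewrite comul_antip tlift_tlift; apply: eq_tlift => q1 q2; rewrite tliftE //; lin.
rewrite -(comul_coassoc (p := 1%g)) ?e11 //.
pose G q2 := \tsum_(y1 : H 1%g, y2 : H 1%g <- D y) (lam 1%g (S q2 * y1) *: y2).
have lG : linear G by rewrite /G; lin.
rewrite -[RHS]/(G h) -(comul_counitl h lG); apply: eq_tlift => r q2.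
rewrite /G tlift_scale /F exchange_tlift; apply: eq_tlift => y1 y2.
have ly : linear (fun z : H 1%g => lam 1%g (S q2 * y1) *: (z * y2)) by lin.
rewrite -[y2 in RHS]mul1r -(antipr r e11 ly); apply: eq_tlift => p q1.
by rewrite mulrA.
Qed.

Variables (z0 : H 1%g) (z0_neq0 : lam 1%g z0 != 0).

(* The kernel N of h |-> lam (S h * _) is a left ideal and, by                *)
(* [lam_antip_comul], a left coideal. From eps h = S(h1) h2 in N and 1 \notin  *)
(* N one gets eps = 0 on N, hence N = 0 by the counit axiom.                  *)
Lemma lam_antip_nondeg h : (forall y, lam 1%g (S h * y) = 0) -> h = 0.
Proof.
pose P h := forall y, lam 1%g (S h * y) = 0.
have Psum g y : P g -> \tsum_(p, q <- D g) (lam 1%g (S q * y) *: p) = 0.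
  move=> Pg; rewrite lam_antip_comul.
  by apply: tlift_eq0 => p q; rewrite Pg scale0r.
have Peps g : P g -> eps H g = 0.
  move=> Pg.
  (* Applying lam(S(_) z0) to S(g1) g2 = eps(g) 1 gives eps(g) lam(z0) as the sum of lam(S(g2)
     S(S(g1)) z0), which vanishes by [Psum] contracted at y = S(S(g1)) z0. *)
  have lSS : linear (fun p : H 1%g => S (S p) * z0) by lin.
  have lb q : scalar (fun y : H 1%g => lam 1%g (S q * y)) by apply: scalar_comp; lin.
  have := tlift_scaler_eq0 (1 : H 1%g) lb lSS (fun y => Psum g y Pg).
  have lf : linear (fun w : H 1%g => lam 1%g (S w * z0) *: (1 : H 1%g)) by lin.
  have := antipl g e11 lf; rewrite (antip1 H e11) mul1r => + E.
  have -> : \tsum_(p : H 1%g, q : H 1%g <- D g)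
              (lam 1%g (S (S p * q) * z0) *: (1 : H 1%g)) = 0.
    by rewrite -[RHS]E; apply: eq_tlift => p q; rewrite (antipM e11) mulrA.
  move/esym/eqP; rewrite !scaler_eq0 (negPf z0_neq0) => /orP[/eqP //|].
  by move/eqP=> e1; have := eps1 H; rewrite e1 linear0 => /esym/eqP; rewrite oner_eq0.
move=> Ph; apply: scalar_eq0 => f lf; apply: scale1_inj; rewrite scale0r.
have lF : linear (fun p : H 1%g => f p *: (1 : H 1%g)) by lin.
pose hf := \tsum_(p, q <- D h) (f p *: q).
have Phf : P hf.
  move=> y; apply: scale1_inj; rewrite scale0r.
  have lG : linear (fun g : H 1%g => lam 1%g (S g * y) *: (1 : H 1%g)) by lin.
  rewrite [LHS](linear_tlift _ _ lG).
  have lf1 : linear (fun p : H 1%g => f p *: (1 : H 1%g)) by lin.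
  have := linear_tlift (fun p q => lam 1%g (S q * y) *: p) (D h) lf1.
  rewrite Psum // => E; transitivity (f 0 *: (1 : H 1%g)).
    rewrite E; apply: eq_tlift => p q.
    rewrite (linear_scalE _ _ lG) (linear_scalE _ _ lf1).
    by rewrite !scalerA mulrC.
  by rewrite scalar0 ?scale0r.
have le : linear (fun g : H 1%g => eps H g *: (1 : H 1%g)) by lin.
rewrite -(scale0r (1 : H 1%g)) -(Peps _ Phf) [RHS](linear_tlift _ _ le).
rewrite -[LHS](comul_counitr h lF); apply: eq_tlift => p q.
by rewrite (linear_scalE _ _ le) !scalerA mulrC.
Qed.

Lemma antip_surj1 x : exists y, S y = x.
Proof.
apply: (linear_inj_surj (f := S)) => // h Sh.
by apply: lam_antip_nondeg => y; rewrite Sh mul0r linear0.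
Qed.

(** L represents the counit for the nondegenerate form lam(S(h) y). Since S is onto and lam(S(h)
    S(y) L) = lam(S(y h) L) = eps(y h), it is a left integral; h = 1 gives lam(L) = 1. *)
Lemma integral_exists : exists2 L, left_integral L & lam 1%g L = 1.
Proof.
pose b h y := lam 1%g (S h * y).
have lb1 h : scalar (b h) by apply: scalar_comp; lin.
have lb2 y : scalar (b^~ y).
  by apply: (scalar_comp (F := lam 1%g) (f := fun h => S h * y)); lin.
have [rnd rep] := nondegenerate_right lb1 lb2 lam_antip_nondeg.
have [L bL] := rep _ (scalarP (eps H)); exists L.
  move=> x; have [y <-] := antip_surj1 x.
  apply/subr0_eq/rnd => h; rewrite /b mulrBr linearB /=.
  rewrite mulrA -(antipM e11) -[lam _ _]/(b _ _) bL -fdscalerAr linearZ /=.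
  by rewrite -/(b _ _) bL epsM eps_antip mulrC subrr.
by rewrite -[L]mul1r -(antip1 H e11) -/(b _ _) bL eps1.
Qed.

End Integral.

Section IntegralPair.
Variables (k : fieldType) (pi : groupType) (H : hopfPiCoalgebra k pi).
Variables (L : H 1%g) (Ll : left_integral L) (Lr : right_integral L).
Variables (a b : pi) (ab : (a * b = 1)%g).

Let ba : (b * a = 1)%g.
Proof. exact: mulg_eq1C. Qed.

(** Insert y2 S(y3) in the second leg; then L1 y1 and L2 y2 are the legs of Delta(L y'), and L
    absorbs y' into a counit. The mirror argument gives [integral_mull]. *)
Lemma integral_mulr (y : H a) (U : lmodType k) (f : H a -> H b -> U) : bilin f ->
  \tsum_(p : H a, q : H b <- comul a b L) f (p * y) q =
  \tsum_(p : H a, q : H b <- comul a b L) f p (q * antip b y).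
Proof.
move=> bf; have [l1 l2] := bf.
transitivity (\tsum_(p : H a, q : H b <- comul a b L)
    comul3 b y (fun y1 y2 y3 => f (p * y1) (q * (y2 * antip b y3)))).
  apply: eq_tlift => p q.
  have b1 : bilin (fun (u : H a) (v : H b) => f (p * u) (q * v)) by lin.
  by rewrite (comul3_antipr ab y b1) mulr1.
rewrite /comul3 exchange_tlift.
have ly : linear (fun y : H a =>
    \tsum_(p : H a, q : H b <- comul a b L) f p (q * antip b y)).
  by lin.
rewrite -(comul_counitl y ly); apply: eq_tlift => y0 y3.
pose g (u : H a) (v : H b) := f u (v * antip b y3).
have bg : bilin g by rewrite /g; lin.
rewrite -[RHS](linear_scalE _ _ (tlift_linear g)) -linearZ /= -Lr comulM ?ab //.
by apply: eq_tlift => p q; apply: eq_tlift => y1 y2; rewrite /g mulrA.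
Qed.

Lemma integral_mull (x : H b) (U : lmodType k) (f : H a -> H b -> U) : bilin f ->
  \tsum_(p : H a, q : H b <- comul a b L) f p (x * q) =
  \tsum_(p : H a, q : H b <- comul a b L) f (antip a x * p) q.
Proof.
move=> bf; have [l1 l2] := bf.
transitivity (\tsum_(p : H a, q : H b <- comul a b L)
    comul3 a x (fun x1 x2 x3 => f (antip a x1 * x2 * p) (x3 * q))).
  apply: eq_tlift => p q.
  have b1 : bilin (fun (u : H a) (v : H b) => f (u * p) (v * q)) by lin.
  by rewrite (comul3_antipl ba x b1) mul1r.
have ly : linear (fun x : H b =>
    \tsum_(p : H a, q : H b <- comul a b L) f (antip a x * p) q).
  by lin.
rewrite -(comul_counitr x ly).
transitivity (\tsum_(x1, y <- comul b 1%g x) \tsum_(x2 : H a, x3 : H b <- comul a b y)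
   \tsum_(p : H a, q : H b <- comul a b L) f (antip a x1 * x2 * p) (x3 * q)).
  rewrite -(comul3_assoc ba) ?[RHS]/comul3; try by lin.
  by rewrite exchange_tlift; apply: eq_tlift => x0 x3; rewrite exchange_tlift.
apply: eq_tlift => x1 y.
pose g (u : H a) (v : H b) := f (antip a x1 * u) v.
have bg : bilin g by rewrite /g; lin.
rewrite -[RHS](linear_scalE _ _ (tlift_linear g)) -linearZ /= -Ll comulM ?ab //.
by apply: eq_tlift => p q; apply: eq_tlift => y1 y2; rewrite /g mulrA.
Qed.

Variable lam : forall a : pi, {scalar H a}.
Hypotheses (lam_int : right_piIntegral lam) (lamL : lam 1%g L = 1).

Lemma lam_integral (U : lmodType k) (f : H b -> U) : linear f ->
  \tsum_(p, q <- comul a b L) (lam a p *: f q) = f 1.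
Proof. by move=> lf; rewrite lam_comul ?ab // lamL scale1r. Qed.

Lemma lam_integral_mulr (y : H a) (U : lmodType k) (f : H b -> U) : linear f ->
  \tsum_(p : H a, q : H b <- comul a b L) (lam a (p * y) *: f q) = f (antip b y).
Proof.
move=> lf; have bf : bilin (fun p q => lam a p *: f q) by lin.
rewrite (integral_mulr y bf).
have l1 : linear (fun z : H b => f (z * antip b y)) by lin.
by rewrite (lam_integral l1) mul1r.
Qed.

Lemma lam_integral_mull (z : H b) (U : lmodType k) (f : H b -> U) : linear f ->
  \tsum_(p : H a, q : H b <- comul a b L) (lam a (antip a z * p) *: f q) = f z.
Proof.
move=> lf; have bf : bilin (fun p q => lam a p *: f q) by lin.
rewrite -(integral_mull z bf).
have l1 : linear (fun w : H b => f (z * w)) by lin.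
by rewrite (lam_integral l1) mulr1.
Qed.

Lemma antip_eq0 (z : H b) : antip a z = 0 -> z = 0.
Proof.
move=> z0; rewrite -(lam_integral_mull z (@linear_id k (H b))).
by apply: tlift_eq0 => p q; rewrite z0 mul0r linear0 scale0r.
Qed.

End IntegralPair.

Section Nakayama.
Variables (k : fieldType) (pi : groupType) (H : hopfPiCoalgebra k pi).
Variables (L : H 1%g) (Ll : left_integral L) (Lr : right_integral L).
Variable lam : forall a : pi, {scalar H a}.
Hypotheses (lam_int : right_piIntegral lam) (lamL : lam 1%g L = 1).
Variables (a b : pi) (ab : (a * b = 1)%g).

Let ba : (b * a = 1)%g.
Proof. exact: mulg_eq1C. Qed.

Lemma dim_hopf : dim (H a) = dim (H b).
Proof.
apply/eqP; rewrite eqn_leq.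
rewrite (linear_inj_dim (f := @antip k pi H a b)); last first.
  exact: (antip_eq0 Ll ba lam_int lamL).
rewrite (linear_inj_dim (f := @antip k pi H b a)) //.
exact: (antip_eq0 Ll ab lam_int lamL).
Qed.

(* By [lam_integral_mull] the first legs of Delta L pair onto H b; as H a and  *)
(* H b have the same dimension, these legs also exhaust H a.                  *)
Lemma integral_slice_eq0 (g : H a -> k) : scalar g ->
  \tsum_(p, q <- comul a b L) (g p *: q) = 0 -> forall x, g x = 0.
Proof.
apply: tens_slice_eq0 => [|z]; first exact: dim_hopf.
exists (fun p => lam a (antip a z * p)); first by apply: scalar_comp; lin.
exact: (lam_integral_mull Ll ab lam_int lamL z (@linear_id k (H b))).
Qed.

(** Both functionals of x, paired with the first leg of Delta(L), give S(y). *)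
Lemma lam_mulC (x y : H a) : lam a (x * y) = lam a (antip a (antip b y) * x).
Proof.
apply/subr0_eq; move: x.
apply: (@integral_slice_eq0
  (fun x => lam a (x * y) - lam a (antip a (antip b y) * x))).
  move=> c u v; rewrite mulrDl mulrDr -fdscalerAl -fdscalerAr !linearD !linearZ /=.
  by rewrite mulrBr opprD addrACA.
rewrite (eq_tlift (b' := fun (p : H a) (q : H b) => lam a (p * y) *: q -
  lam a (antip a (antip b y) * p) *: q)) => [|p q]; last exact: scalerBl.
rewrite tlift_sub.
rewrite (lam_integral_mulr Lr ab lam_int lamL y (@linear_id k (H b))).
by rewrite (lam_integral_mull Ll ab lam_int lamL _ (@linear_id k (H b))) subrr.
Qed.

End Nakayama.

Section CrossingFactor.
Variables (k : fieldType) (pi : groupType) (H : crossedPiCoalgebra k pi).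
Variables (L : H 1%g) (Ll : left_integral L) (Lr : right_integral L).
Variable lam : forall a : pi, {scalar H a}.
Hypotheses (lam_int : right_piIntegral lam) (lamL : lam 1%g L = 1).

(** Pair with Delta(L) and apply phi_g to the second leg: both sides become lam_1(phi_g(L)) 1. *)
Lemma lam_cross g a c (x : H a) : c = cj g a ->
  lam c (cross g c x) = lam 1%g (cross g 1%g L) * lam a x.
Proof.
move=> ec; pose b := a^-1%g; have ab : (a * b = 1)%g by rewrite mulgV.
pose d := cj g b; have cd : (c * d = 1)%g by rewrite ec -cjM ab cj1.
set r := lam _ (cross g 1%g L).
apply/subr0_eq; move: x.
apply: (integral_slice_eq0 Ll lam_int lamL ab
  (g := fun x => lam c (cross g c x) - r * lam a x)).
  move=> e u v; rewrite !linearP /= mulrDr mulrBr opprD addrACA.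
  by congr (_ - _ + _); rewrite mulrCA.
have injd : injective (cross g d : H b -> H d).
  by apply: (can_inj (g := cross g^-1%g b)) => y; apply: crossK.
apply: injd.
rewrite linear0 linear_tlift; last by lin.
rewrite (eq_tlift (b' := fun (p : H a) (q : H b) =>
  lam c (cross g c p) *: cross g d q - r *: (lam a p *: cross g d q))); last first.
  by move=> p q; rewrite linearZ /= scalerBl scalerA.
rewrite tlift_sub -tlift_scale.
have ld : linear (cross g d : H b -> H d) by lin.
rewrite [X in _ - _ *: X](lam_integral ab lam_int lamL ld).
have bd : bilin (fun (p : H c) (q : H d) => lam c p *: q) by lin.
rewrite -(comul_cross L ec (erefl d) (esym ab) (esym cd) bd).
rewrite (lam_comul lam_int _ (esym cd) (@linear_id k (H d))) -/r.
by rewrite cross1 ?subrr.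
Qed.

(* A simple left ideal on which eps does not vanish meets ker eps trivially,  *)
(* so it consists of integrals; hence eps L <> 0, as in Maschke's theorem.    *)
Lemma cross_factor_semisimple g : semisimple_algebra (H 1%g) ->
  lam 1%g (cross g 1%g L) = 1.
Proof.
case=> n [N [simpleN sumN _]].
have [K KE] := kernel_vspace (scalarP (eps H)).
have /existsP[i Ni] : [exists i, ~~ (N i <= K)%VS].
  rewrite -negb_forall; apply/negP=> /forallP NK.
  have : (1 : H 1%g) \in K.
    have : ((\sum_i N i)%VS <= K)%VS by apply/subv_sumP=> i _.
    by rewrite sumN => /subvP; apply; apply: memvf.
  by rewrite KE eps1 oner_eq0.
have [idN _ minN] := simpleN i.
have [x xN] := subvPn Ni; rewrite KE => ex.
have N'0 : (N i :&: K = 0)%VS.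
  have [|||N'E] // := minN (N i :&: K)%VS.
  - move=> a y; rewrite !memv_cap => /andP[yN]; rewrite !KE epsM => /eqP->.
    by rewrite mulr0 eqxx idN.
  - exact: capvSl.
  by move: Ni; rewrite -{1}N'E capvSr.
have xl : left_integral x.
  move=> y; apply/subr0_eq/eqP; rewrite -memv0 -N'0 memv_cap KE.
  apply/andP; split; first by rewrite memvB ?memvZ ?idN.
  by rewrite linearB /= epsM linearZ /= subrr.
(* L x equals both eps(L) x and eps(x) L, and L is non-zero. *)
have eL : eps H L != 0.
  apply: contraNneq ex => eL; have := xl L; rewrite eL scale0r Lr => /eqP.
  rewrite scaler_eq0 => /orP[//|/eqP L0]; have := lamL.
  by rewrite L0 linear0 => /esym/eqP; rewrite oner_eq0.
(* L phi(L) is eps(L) L since L is a right integral, and eps(L) phi(L) since it is phi(phi^-1(L) L)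
   and L is a left integral. *)
have := Lr (cross g 1%g L); rewrite eps_cross.
have e1 : (1 = cj g 1 :> pi)%g by rewrite cj1.
have -> : L * cross g 1%g L = eps H L *: cross g 1%g L.
  have := crossK (g := g^-1%g) L; rewrite invgK => /(_ 1%g).
  rewrite mulg1 mulVg => /(_ erefl) {1}<-.
  by rewrite -crossM // Ll eps_cross linearZ.
by move=> E; have -> : cross g 1%g L = L by apply: (scalerI eL).
Qed.

End CrossingFactor.

Section Cosemisimple.
Variables (k : fieldType) (pi : groupType) (H : hopfPiCoalgebra k pi).
Variable lam : forall a : pi, {scalar H a}.
Hypothesis lam_int : right_piIntegral lam.

Lemma mem_recast (N : forall a, {vspace H a}) a b (x : H a) : a = b ->
  x \in N a -> recast b x \in N b.
Proof. by move=> e; case: b / e; rewrite recast_id. Qed.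

(* Dually, a simple subcomodule on which lam does not vanish meets ker lam    *)
(* trivially, so its component at 1 is spanned by a coinvariant, i.e. by 1.   *)
Lemma cosemisimple_lam1 (z : H 1%g) : lam 1%g z != 0 -> cosemisimple H ->
  lam 1%g (1 : H 1%g) != 0.
Proof.
move=> lz [I [N [simpleN genN _]]].
pose K a := sval (kernel_vspace (scalarP (lam a))).
have KE a x : (x \in K a) = (lam a x == 0).
  exact: (svalP (kernel_vspace (scalarP (lam a)))).
have [i Ni] : exists i, ~~ (N i 1%g <= K 1%g)%VS.
  have [s zs] := genN _ z.
  have [NK|/allPn[i _ Ni]] := boolP (all (fun i => N i 1%g <= K 1%g)%VS s).
    suff sK : ((\sum_(i <- s) N i 1%g)%VS <= K 1%g)%VS.
      by move: (subvP sK _ zs); rewrite KE (negPf lz).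
    rewrite big_seq; apply: (big_ind (fun U : {vspace H 1%g} => (U <= K 1%g)%VS)).
    - exact: sub0v.
    - by move=> U V UK VK; rewrite subv_add UK.
    - by move=> i /(allP NK).
  by exists i.
have [comN _ minN] := simpleN i.
have [e eN] := subvPn Ni; rewrite KE => le.
have comN' : subcomodule (fun a => N i a :&: K a)%VS.
  move=> a b x; rewrite memv_cap KE => /andP[/(comN a b x)/tensv_fullP xN /eqP lx].
  apply/tensv_fullP => j.
  rewrite memv_cap xN KE /=; apply/eqP.
  by apply: tens_slice_scalar; [apply: scalarP | rewrite lam_int lx scale0r].
have N'0 : (N i 1%g :&: K 1%g = 0)%VS.
  have [|/(_ 1%g)//|/(_ 1%g) N'E] := minN _ comN'; first by move=> a; exact: capvSl.
  by move: Ni; rewrite -{1}N'E capvSr.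
(* The slices of the difference lie in [N i 1] and are killed by [lam], as both tensors contract to
   lam(e) 1. *)
have De : comul 1%g 1%g e = pure e (1 : H 1%g).
  apply/subr0_eq/tens_slice_eq => j; apply/eqP; rewrite -memv0 -N'0 memv_cap KE.
  apply/andP; split.
    apply/tensv_fullP: j; rewrite memvB //.
      by apply/comN/mem_recast => //; rewrite mulg1.
    by apply: pure_tensv => //; apply: memvf.
  apply/eqP/tens_slice_scalar; first exact: scalarP.
  rewrite linearB /= (lam_comul lam_int _ _ (@linear_id k (H 1%g))) ?mulg1 //.
  by rewrite tliftE ?subrr //; lin.
have := comul_counitl e (@linear_id k (H 1%g)); rewrite De tliftE; last by lin.
by move=> eE; apply: contraNneq le => l1; rewrite -eE linearZ /= l1 mulr0.
Qed.

End Cosemisimple.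

(** * R-matrix and Drinfeld elements *)

Section Rmatrix.
Variables (k : fieldType) (pi : groupType) (H : qtPiCoalgebra k pi).
Implicit Types a b c d e g : pi.

Lemma Rmat_comul a b c e (x : H e) : e = (a * b)%g -> c = cj a b ->
  Rmat H a b * comul a b x =
  (\tsum_(p : H c, q : H a <- comul c a x)
     (pure q (cross a^-1%g b p) : tens (H a) (H b))) * Rmat H a b.
Proof.
move=> ee ec; subst e c; rewrite /comul recast_id Rmat_Delta; congr (_ * _).
rewrite /swap_phiV /tswap /tmap tlift_tlift (recastE (esym (mulgVK a (a * b)%g))).
apply: eq_tlift => p q; rewrite tliftE; last by lin.
by rewrite /phiV (recastE (cjVK a b)).
Qed.

Section Hexagon.
Variables (a b c : pi) (U : lmodType k) (f : H a -> H b -> H c -> U).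
Hypotheses (l1 : forall v w, linear (fun u => f u v w))
  (l2 : forall u w, linear (fun v => f u v w)) (l3 : forall u v, linear (f u v)).

Let lf u : linear (tlift (f u)). Proof. exact: tlift_linear. Qed.
Let l4 t : linear (fun u => tlift (f u) t). Proof. lin. Qed.
Let bf u : bilin (f u). Proof. by split=> ?; auto. Qed.
Let bF : bilin (fun u => tlift (f u)). Proof. by split. Qed.

Lemma Rmat_comull d e : e = (a * b)%g -> d = cj b c ->
  \tsum_(p, q <- Rmat H e c) \tsum_(u, v <- comul a b p) f u v q =
  \tsum_(p : H a, q : H d <- Rmat H a d) \tsum_(r : H b, s : H c <- Rmat H b c)
     f p r (cross b^-1%g c q * s).
Proof.
move=> ee ed; subst e d; have := Rmat_Deltal H a b c.
move/(congr1 (tlift (fun u => tlift (f u)))).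
rewrite /tassoc /tmap /leg13 tens_tlift_mull !tlift_tlift => E.
transitivity (\tsum_(p, q <- Rmat H (a * b)%g c)
  \tsum_(u, v <- Delta H a b p) f u v q).
  by apply: eq_tlift => p q; rewrite /comul recast_id.
move: E; congr (_ = _); apply: eq_tlift => p q.
  rewrite tliftE; last by lin.
  rewrite !tlift_tlift; apply: eq_tlift => u v.
  by rewrite tliftE ?tliftE //; lin.
rewrite tliftE; last by lin.
rewrite /leg23 pureM mulr1 tliftE // -{1}[Rmat H b c]tlift_pure.
rewrite tens_tlift_mulr tlift_tlift.
apply: eq_tlift => r s; rewrite pureM mul1r tliftE //.
by rewrite /phiV (recastE (cjVK b c)).
Qed.

Lemma Rmat_comulr e : e = (b * c)%g ->
  \tsum_(p, q <- Rmat H a e) \tsum_(u, v <- comul b c q) f p u v =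
  \tsum_(p' : H a, q' : H c <- Rmat H a c) \tsum_(p : H a, q : H b <- Rmat H a b)
    f (p' * p) q q'.
Proof.
move=> ee; subst e; have := Rmat_Deltar H a b c.
move/(congr1 (tlift (fun u => tlift (f u)))).
rewrite /tmap /leg13 /leg12 tens_tlift_mull !tlift_tlift => E.
transitivity (\tsum_(p, q <- Rmat H a (b * c)%g)
  \tsum_(u, v <- Delta H b c q) f p u v).
  by apply: eq_tlift => p q; rewrite /comul recast_id.
move: E; congr (_ = _); apply: eq_tlift => p q; first by rewrite tliftE.
rewrite tens_tlift_mulr tlift_tlift; apply: eq_tlift => r s.
by rewrite !pureM mul1r mulr1 !tliftE.
Qed.

End Hexagon.

Lemma Rmat_cross g a b c d : c = cj g a -> d = cj g b ->
  Rmat H c d = tmap (cross g c) (cross g d) (Rmat H a b).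
Proof.
move=> ec ed; subst c d; rewrite -Rmat_phi; apply: eq_tlift => p q.
by rewrite /cross !recast_id.
Qed.

Lemma Rmat_lcancel a b (t : tens (H a) (H b)) : t * Rmat H a b = Rmat H a b -> t = 1.
Proof.
have [y [_ yR]] := Rmat_inv H a b.
by move/(congr1 ( *%R^~ y)); rewrite -mulrA yR mulr1.
Qed.

Lemma drinfeldE a b : (a * b = 1)%g ->
  drinfeld H a = \tsum_(p : H a, q : H b <- Rmat H a b) (antip a (cross a b q) * p).
Proof.
move=> ab; have eb : b = a^-1%g by rewrite -[b](mulKg a) ab mulg1.
subst b; rewrite /drinfeld /tswap tlift_tlift; apply: eq_tlift => p q.
rewrite tliftE.
  by rewrite (recastE (cj_inv a)) (recastE (invgK a)).
split=> [z|z] c u v /=; first by rewrite mulrDr -fdscalerAr.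
by rewrite !(recastE (cj_inv a)) !(recastE (invgK a)) !linearP mulrDl -fdscalerAl.
Qed.

End Rmatrix.

Section Drinfeld.
Variables (k : fieldType) (pi : groupType) (H : qtPiCoalgebra k pi).
Variables (a b : pi) (ab : (a * b = 1)%g).

Let ba : (b * a = 1)%g.
Proof. exact: mulg_eq1C. Qed.
Let aV : a^-1%g = b.
Proof. exact: invg_eq. Qed.
Let eb : b = cj a b.
Proof. by rewrite ab mul1g aV. Qed.
Let crossVK (x : H b) : cross a b (cross a^-1%g b x) = x.
Proof. by rewrite cross_cross // ?mulgV ?cross_id // {1 2}aV mulgK. Qed.
Let ea : a = cj a a.
Proof. by rewrite mulgK. Qed.

(** Evaluate S^2(phi(x3)) F(R (x1 (x) x2)) twice. Exchanging R with the comultiplication produces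
    S(p) q, which cancels; expanding directly produces S(phi(x2 S(x3))), which cancels too. *)
Lemma drinfeld_antip2 (x : H a) :
  antip a (antip b (cross a a x)) * drinfeld H a = drinfeld H a * x.
Proof.
pose F := tlift (fun (p : H a) (q : H b) => antip a (cross a b q) * p).
have lF : linear F by apply: tlift_linear.
have uE : F (Rmat H a b) = drinfeld H a by rewrite (drinfeldE H ab).
set u := drinfeld H a in uE *.
have bf : bilin (fun (p : H a) (q : H b) => antip a (cross a b q) * p) by lin.
transitivity (comul3 b x (fun x1 x2 x3 =>
   antip a (antip b (cross a a x3)) * F (Rmat H a b * pure x1 x2))).
  have lx : linear (fun x3 : H a => antip a (antip b (cross a a x3)) * u) by lin.
  rewrite -(comul_counitl x lx); apply: eq_tlift => x0 x3.
  rewrite -tlift_mulr fdscalerAr; congr (_ * _).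
  rewrite -(linear_tlift _ _ lF) -tlift_mulr tlift_pure.
  rewrite (Rmat_comul x0 (esym ab) eb).
  rewrite tlift_mull (linear_tlift _ _ lF).
  pose h (z : H a) := \tsum_(r : H a, s : H b <- Rmat H a b)
    (antip a (cross a b s) * z * r).
  have lh : linear h by rewrite /h; lin.
  have hE : h 1 = u by rewrite -uE; apply: eq_tlift => r s; rewrite mulr1.
  rewrite -hE -(antipl x0 ba lh); apply: eq_tlift => p q.
  rewrite /F tlift_mul // tliftE; last by lin.
  by apply: eq_tlift => r s; rewrite crossM // (antipM ba) crossVK !mulrA.
pose f (x1 : H a) (r : H b) := antip a (cross a b r) * (u * x1).
have bff : bilin f by rewrite /f; lin.
transitivity (f x 1); last by rewrite /f cross1 // (antip1 H ba) mul1r.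
rewrite -(comul3_antipr ab x bff); apply: eq_comul3 => x1 x2 x3.
rewrite /F tlift_mul // /f -uE /F tlift_mull !tlift_mulr; apply: eq_tlift => r s.
rewrite tliftE; last by lin.
rewrite !crossM // -(antip_cross (a := a) (a' := a) x3 ab ea eb) !(antipM ba).
by rewrite !mulrA.
Qed.

End Drinfeld.

Section RmatrixAntipode.
Variables (k : fieldType) (pi : groupType) (H : qtPiCoalgebra k pi).
Variables (a b : pi) (ab : (a * b = 1)%g).

Let ba : (b * a = 1)%g.
Proof. exact: mulg_eq1C. Qed.
Let aV : a^-1%g = b.
Proof. exact: invg_eq. Qed.
Let ea : a = cj a a.
Proof. by rewrite mulgK. Qed.

(** Applying the counit to the first leg of the hexagon gives E R = R with R invertible; the
    crossing in E is undone at the end. *)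
Lemma Rmat_epsl :
  \tsum_(p, q <- Rmat H 1%g a) pure (eps H p *: (1 : H a)) q = 1 :> tens (H a) (H a).
Proof.
pose E : tens (H a) (H a) :=
  \tsum_(p, q <- Rmat H 1%g a) pure (eps H p *: (1 : H a)) (cross b a q).
have E1 : E = 1.
  apply: (@Rmat_lcancel _ _ H a a).
  pose f (u : H 1%g) (v w : H a) := pure (eps H u *: v) w.
  transitivity (\tsum_(p, q <- Rmat H a a) \tsum_(u, v <- comul 1%g a p) f u v q).
    rewrite (Rmat_comull _ _ _ (esym (mul1g a)) ea); try by rewrite /f; lin.
    rewrite -[LHS]tlift_pure tlift_mul; last by lin.
    rewrite tlift_tlift; apply: eq_tlift => p q; rewrite tliftE; last by lin.
    by apply: eq_tlift => r s; rewrite /f -fdscalerAl mul1r aV.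
  rewrite -[RHS]tlift_pure; apply: eq_tlift => p q.
  have lp : linear (fun z : H a => pure z q) by lin.
  rewrite -(comul_counitl p lp); apply: eq_tlift => u v.
  by rewrite /f (linear_scalE _ _ lp).
have := congr1 (tlift (fun u v : H a => pure u (cross a a v))) E1.
rewrite -pure11 tlift_tlift tliftE; last by lin.
rewrite cross1 // => <-; apply: eq_tlift => p q; rewrite tliftE; last by lin.
by rewrite cross_cross // ?ab ?cross_id // -aV invgK mulVg mul1g.
Qed.

Lemma Rmat_epsr :
  \tsum_(p, q <- Rmat H a 1%g) pure p (eps H q *: (1 : H b)) = 1 :> tens (H a) (H b).
Proof.
apply: (@Rmat_lcancel _ _ H a b).
pose f (u : H a) (v : H b) (w : H 1%g) := pure u (eps H w *: v).
transitivity (\tsum_(p, q <- Rmat H a b) \tsum_(u, v <- comul b 1%g q) f p u v).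
  rewrite (Rmat_comulr _ _ _ (esym (mulg1 b))); try by rewrite /f; lin.
  rewrite -[LHS]tlift_pure tlift_mul; last by lin.
  rewrite tlift_tlift; apply: eq_tlift => p q; rewrite tliftE; last by lin.
  by apply: eq_tlift => r s; rewrite /f -fdscalerAl mul1r.
rewrite -[RHS]tlift_pure; apply: eq_tlift => p q.
have lq : linear (fun z : H b => pure p z) by lin.
rewrite -(comul_counitr q lq); apply: eq_tlift => u v.
by rewrite /f (linear_scalE _ _ lq).
Qed.

(** Crossed analogue of the formula (S (x) id)(R) for the inverse of R. *)
Let X : tens (H a) (H a) :=
  \tsum_(p, q <- Rmat H b a) pure (antip a p) (cross b a q).

Let Rmat_linv : X * Rmat H a a = 1.
Proof.
rewrite -Rmat_epsl.
pose f (u : H b) (v w : H a) := pure (antip a u * v) w.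
transitivity (\tsum_(p, q <- Rmat H 1%g a) \tsum_(u, v <- comul b a p) f u v q).
  rewrite (Rmat_comull _ _ _ (esym ba) ea); try by rewrite /f; lin.
  rewrite -[LHS]tlift_pure tlift_mul; last by lin.
  rewrite tlift_tlift; apply: eq_tlift => p q; rewrite tliftE; last by lin.
  by apply: eq_tlift => r s; rewrite /f aV.
apply: eq_tlift => p q.
have lp : linear (fun z : H a => pure z q) by lin.
by rewrite (linear_scalE _ _ lp) -(antipl p ba lp).
Qed.

Let Rmat_rinv :
  \tsum_(p' : H a, q' : H a <- Rmat H a a) \tsum_(p : H a, q : H b <- Rmat H a b)
    (pure (p' * p) (q * antip b q') : tens (H a) (H b)) = 1.
Proof.
rewrite -Rmat_epsr.
pose f (u : H a) (v : H b) (w : H a) := pure u (v * antip b w).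
rewrite -(Rmat_comulr (f := f) _ _ _ (esym ba)); try by rewrite /f; lin.
apply: eq_tlift => p q.
have lq : linear (fun z : H b => pure p z) by lin.
by rewrite (linear_scalE _ _ lq) -(antipr q ba lq).
Qed.

(* Both sides equal X * R_(a,a) * R_(a,b) with the second tensor factor       *)
(* multiplied in an order mixed by S; the two bracketings of the product      *)
(* collapse by [Rmat_linv] and by [Rmat_rinv] respectively.                   *)
Lemma Rmat_antip :
  Rmat H a b = \tsum_(p, q <- Rmat H b a) pure (antip a p) (antip b (cross b a q)).
Proof.
pose g (c d p' q' p : H a) (q : H b) : tens (H a) (H b) :=
  pure (c * (p' * p)) (q * antip b q' * antip b d).
transitivity (\tsum_(c, d <- X) \tsum_(p', q' <- Rmat H a a)
    \tsum_(p, q <- Rmat H a b) g c d p' q' p q).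
  transitivity (\tsum_(p : H a, q : H b <- Rmat H a b)
    \tsum_(m : H a, n : H a <- X * Rmat H a a) pure (m * p) (q * antip b n)).
    rewrite -[LHS]tlift_pure; apply: eq_tlift => p q.
    rewrite Rmat_linv -pure11 tliftE; last by lin.
    by rewrite (antip1 H ab) mul1r mulr1.
  transitivity (\tsum_(p, q <- Rmat H a b) \tsum_(c, d <- X)
    \tsum_(p', q' <- Rmat H a a) g c d p' q' p q).
    apply: eq_tlift => p q; rewrite tlift_mul; last by lin.
    apply: eq_tlift => c d; apply: eq_tlift => p' q'.
    by rewrite /g (antipM ab) !mulrA.
  by rewrite exchange_tlift; apply: eq_tlift => c d; rewrite exchange_tlift.
transitivity (\tsum_(c : H a, d : H a <- X) (pure c (antip b d) : tens (H a) (H b))).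
  apply: eq_tlift => c d.
  pose F := tlift (fun (m : H a) (n : H b) =>
    pure (c * m) (n * antip b d) : tens (H a) (H b)).
  have := congr1 F Rmat_rinv; rewrite /F -pure11 tliftE; last by lin.
  rewrite mulr1 mul1r => <-; rewrite tlift_tlift; apply: eq_tlift => p' q'.
  by rewrite tlift_tlift; apply: eq_tlift => p q; rewrite tliftE //; lin.
by rewrite tlift_tlift; apply: eq_tlift => p q; rewrite tliftE //; lin.
Qed.

(** [Rmat_antip] turns the sum into S(p) S(S(phi_b(q))) over R_{b,a}, which is S applied to
    S(phi_b(q)) p. *)
Lemma antip_drinfeld :
  \tsum_(p : H a, q : H b <- Rmat H a b) (p * antip a q) = antip a (drinfeld H b).
Proof.
rewrite (drinfeldE H ba) linear_tlift; last by lin.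
rewrite Rmat_antip tlift_tlift; apply: eq_tlift => p q.
by rewrite tliftE ?(antipM ba) //; lin.
Qed.

End RmatrixAntipode.

Section DrinfeldIntegral.
Variables (k : fieldType) (pi : groupType) (H : qtPiCoalgebra k pi).
Variables (a b : pi) (ab : (a * b = 1)%g).

Let ba : (b * a = 1)%g.
Proof. exact: mulg_eq1C. Qed.
Let aV : a^-1%g = b.
Proof. exact: invg_eq. Qed.
Let eb : b = cj a b.
Proof. by rewrite ab mul1g aV. Qed.
Let eb' : b = cj b b.
Proof. by rewrite mulgK. Qed.

Lemma drinfeld_cross g c : c = cj g a -> cross g c (drinfeld H a) = drinfeld H c.
Proof.
move=> ec; pose d := cj g b; have cd : (c * d = 1)%g by rewrite ec -cjM ab cj1.
rewrite (drinfeldE H ab) (drinfeldE H cd) linear_tlift; last by lin.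
rewrite (Rmat_cross H ec (erefl d)) /tmap tlift_tlift; apply: eq_tlift => p q.
rewrite tliftE; last by lin.
rewrite crossM // -(antip_cross _ ba (erefl d) ec) !cross_cross //.
  by have -> : (c * g = g * a)%g by rewrite ec mulgVK.
by rewrite cd mul1g -[RHS]mulg1 -cd mulKg.
Qed.

Variables (L : H 1%g) (Ll : left_integral L) (Lr : right_integral L).
Variable lam : forall a : pi, {scalar H a}.
Hypotheses (lam_int : right_piIntegral lam) (lamL : lam 1%g L = 1).

(* Evaluate lam (first leg * y) on both sides of                              *)
(*   R Delta(L) = (Delta^op(L) twisted by phi) R,                             *)
(* after moving the legs of R through those of L by the integral property:    *)
(* they recombine into S(u_b) on the left and into u_a on the right.          *)
Lemma lam_drinfeld (y : H a) : lam 1%g (cross b 1%g L) = 1 ->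
  lam a (drinfeld H a * y) = lam b (drinfeld H b * antip b y).
Proof.
move=> factor1; set u := drinfeld H a; set v := drinfeld H b.
pose G := tlift (fun (m : H a) (n : H b) => lam a (m * y) *: n).
have bG : bilin (fun (m : H a) (n : H b) => lam a (m * y) *: n) by lin.
(* For R = r (x) s, s moves to the first leg as S(s) and y to the front as S^2(y). The r S(s) sum to
   S(u_b), and S^2(y) S(u_b) = S(u_b S(y)) is stripped by [lam_integral_mull]. *)
have E1 : G (Rmat H a b * comul a b L) = v * antip b y.
  rewrite /G tlift_mul //.
  transitivity (\tsum_(r : H a, s : H b <- Rmat H a b) 
     \tsum_(p : H a, q : H b <- comul a b L)
       (lam a (antip a (antip b y) * (r * antip a s) * p) *: q)).
    apply: eq_tlift => r s.
    have bf : bilin (fun (p : H a) (q : H b) => lam a (r * p * y) *: q) by lin.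
    rewrite (integral_mull Ll ab s bf); apply: eq_tlift => p q.
    by rewrite (lam_mulC Ll Lr lam_int lamL ab) !mulrA.
  rewrite exchange_tlift.
  have l1 := @linear_id k (H b).
  rewrite -[RHS](lam_integral_mull Ll ab lam_int lamL _ l1); apply: eq_tlift => p q.
  pose h (z : H a) := lam a (antip a (antip b y) * z * p) *: q.
  have lh : linear h by rewrite /h; lin.
  rewrite -[LHS](linear_tlift _ _ lh) (antip_drinfeld H ab) /h.
  by rewrite -(antipM ba).
(* After the exchange, s moves to the other leg of Delta_{b,a}(L) as S(phi_a(s)), where it meets r
   and forms u_a. *)
have E2 : G (Rmat H a b * comul a b L) =
    \tsum_(p : H b, q : H a <- comul b a L) (lam a (q * u * y) *: cross b b p).
  rewrite (Rmat_comul L (esym ab) eb) aV /G tlift_mul // tlift_tlift.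
  transitivity (\tsum_(p : H b, q : H a <- comul b a L)
     \tsum_(r : H a, s : H b <- Rmat H a b)
       (lam a (q * r * y) *: cross b b (p * cross a b s))).
    apply: eq_tlift => p q; rewrite tliftE; last by lin.
    apply: eq_tlift => r s; rewrite crossM //.
    by rewrite cross_cross // ba cross_id.
  rewrite exchange_tlift.
  transitivity (\tsum_(r : H a, s : H b <- Rmat H a b)
     \tsum_(p : H b, q : H a <- comul b a L)
       (lam a (q * antip a (cross a b s) * r * y) *: cross b b p)).
    apply: eq_tlift => r s.
    have bf : bilin (fun (p : H b) (q : H a) => lam a (q * r * y) *: cross b b p).
      by lin.
    exact: (integral_mulr Lr ba _ bf).
  rewrite exchange_tlift; apply: eq_tlift => p q.
  pose h (z : H a) := lam a (q * z * y) *: cross b b p.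
  have lh : linear h by rewrite /h; lin.
  have hE (r : H a) (s : H b) :
      lam a (q * antip a (cross a b s) * r * y) *: cross b b p =
      h (antip a (cross a b s) * r) by rewrite /h !mulrA.
  rewrite (eq_tlift _ hE) -(linear_tlift _ _ lh).
  by rewrite -(drinfeldE H ab).
(* Apply [lam b] to both values: [factor1] removes [cross b b], and lam_b(L1) L2 = 1 leaves
   lam_a(u_a y). *)
apply: (scale1_inj (H := H)).
have l1 : linear (fun z : H b => lam b z *: (1 : H 1%g)) by lin.
rewrite -E1 E2 [RHS](linear_tlift _ _ l1).
have l2 : linear (fun q : H a => lam a (q * u * y) *: (1 : H 1%g)) by lin.
have := lam_integral ba lam_int lamL l2; rewrite mul1r => <-; apply: eq_tlift => p q.
rewrite (linear_scalE _ _ l1) (lam_cross Ll lam_int lamL _ eb') factor1 mul1r.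
by rewrite !scalerA mulrC.
Qed.

End DrinfeldIntegral.

(** * The trace *)

Section Ribbon.
Variables (k : fieldType) (pi : groupType) (H : ribbonPiCoalgebra k pi).
Variables (a b : pi) (ab : (a * b = 1)%g).

Let ba : (b * a = 1)%g.
Proof. exact: mulg_eq1C. Qed.
Let aV : a^-1%g = b.
Proof. exact: invg_eq. Qed.

Lemma twist_antip : antip b (twist H a) = twist H b.
Proof. by rewrite /antip antipode_twist -aV recast_id. Qed.

Lemma twistV_antip : antip b (twistV H a) = twistV H b.
Proof.
have := congr1 (antip b) (mulVtwist H a).
rewrite (antipM ab) (antip1 H ab) twist_antip => /(congr1 ( *%R (twistV H b))).
by rewrite mulrA mulVtwist mul1r mulr1.
Qed.

Lemma cross_twist (x : H a) : cross a a x = twistV H a * x * twist H a.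
Proof. by rewrite -phi_twist (recastE (cj_id a)). Qed.

End Ribbon.

Section Trace.
Variables (k : fieldType) (pi : groupType) (H : ribbonPiCoalgebra k pi).
Variables (a b : pi) (ab : (a * b = 1)%g).

Let ba : (b * a = 1)%g.
Proof. exact: mulg_eq1C. Qed.

(** The twist is fixed by S^2 phi_a, which u_a implements. *)
Lemma twist_drinfeldC : twist H a * drinfeld H a = drinfeld H a * twist H a.
Proof.
by rewrite -(drinfeld_antip2 ab) cross_twist mulVtwist mul1r !(twist_antip, ab, ba).
Qed.

(** Conjugation by the twist undoes phi_a in [drinfeld_antip2], so G_a implements S^2. *)
Lemma ribbon_antip2 (x : H a) :
  twist H a * drinfeld H a * x =
  antip a (antip b x) * (twist H a * drinfeld H a).
Proof.
rewrite -mulrA -(drinfeld_antip2 ab) cross_twist !(antipM ab) !(antipM ba).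
rewrite !(twist_antip H ab, twist_antip H ba, twistV_antip H ab, twistV_antip H ba).
by rewrite !mulrA multwistV mul1r.
Qed.

Variables (L : H 1%g) (Ll : left_integral L) (Lr : right_integral L).
Variable lam : forall a : pi, {scalar H a}.
Hypotheses (lam_int : right_piIntegral lam) (lamL : lam 1%g L = 1).
Hypothesis factor1 : forall g, lam 1%g (cross g 1%g L) = 1.

Lemma ribbon_traceC (x y : H a) :
  lam a (twist H a * drinfeld H a * (x * y)) =
  lam a (twist H a * drinfeld H a * (y * x)).
Proof.
by rewrite mulrA (lam_mulC Ll Lr lam_int lamL ab) !mulrA ribbon_antip2 !mulrA.
Qed.

(** With theta moved past u_a, [lam_drinfeld] gives lam_b(u_b S(x) theta_b); the Nakayama formula
    brings theta_b = S^2(theta_b) back to the front. *)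
Lemma ribbon_trace_antip (x : H a) :
  lam b (twist H b * drinfeld H b * antip b x) = lam a (twist H a * drinfeld H a * x).
Proof.
rewrite [in RHS]twist_drinfeldC -[in RHS]mulrA.
rewrite (lam_drinfeld ab Ll Lr lam_int lamL) // (antipM ab) (twist_antip H ab).
rewrite [in RHS]mulrA [RHS](lam_mulC Ll Lr lam_int lamL ba).
by rewrite (twist_antip H ba) (twist_antip H ab) !mulrA.
Qed.

Lemma ribbon_trace_cross g c (x : H a) : c = cj g a ->
  lam c (twist H c * drinfeld H c * cross g c x) =
  lam a (twist H a * drinfeld H a * x).
Proof.
move=> ec; rewrite -(drinfeld_cross H ab ec).
have -> : twist H c = cross g c (twist H a) by rewrite /cross twist_phi -ec recast_id.
by rewrite -!crossM // (lam_cross Ll lam_int lamL _ ec) factor1 mul1r.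
Qed.

End Trace.

Theorem theorem7 (k : fieldType) (pi : groupType) (H : ribbonPiCoalgebra k pi)
    (lam : forall a : pi, {scalar H a}) :
  unimodular H ->
  right_piIntegral lam ->
  semisimple H \/
  cosemisimple H \/
  lam 1%g (twist H 1%g) != 0 \/
  (forall (b : pi) (x : H 1%g), hcast (cj1 b) (phi H b 1%g x) = x) ->
  piTrace (fun (a : pi) (x : H a) => lam a (twist H a * drinfeld H a * x)).
Proof.
move=> Hunimod lam_int conds.
have tr_lin a : scalar (fun x : H a => lam a (twist H a * drinfeld H a * x)).
  by apply: scalar_comp; lin.
have [[z lz]|lam0] := scalar_neq0P (scalarP (lam 1%g)); last first.
  by split=> // *; rewrite !(lam_eq0 lam_int lam0).
have [L Ll lamL] := integral_exists lam_int lz.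
have Lr : right_integral L by apply/Hunimod.
have factorE g x : lam 1%g (cross g 1%g x) = lam 1%g (cross g 1%g L) * lam 1%g x.
  by apply: (lam_cross Ll lam_int lamL); rewrite cj1.
(* One vector fixed by phi_g with non-zero integral forces c(g) = 1: the unit if H is cosemisimple,
   theta_1 if its integral is non-zero. *)
have factor_fixed g x : cross g 1%g x = x -> lam 1%g x != 0 ->
    lam 1%g (cross g 1%g L) = 1.
  by move=> gx lx; apply: (mulIf lx); rewrite -factorE gx mul1r.
have factor1 g : lam 1%g (cross g 1%g L) = 1.
  case: conds => [ss|[cs|[lt|fixed]]].
  - exact: (cross_factor_semisimple Ll Lr lamL g (ss 1%g)).
  - apply: (factor_fixed _ 1); last exact: (cosemisimple_lam1 lam_int lz cs).
    by rewrite cross1 // cj1.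
  - apply: (factor_fixed _ (twist H 1%g)) => //.
    by rewrite /cross twist_phi cj1 recast_id.
  - by rewrite /cross -(recastE (cj1 g)) fixed.
split=> //.
- by move=> a x y; apply: (ribbon_traceC (mulgV a) Ll Lr lam_int lamL).
- move=> a x; rewrite -(ribbon_trace_antip (mulgV a) Ll Lr lam_int lamL) //.
  by rewrite /antip recast_id.
- move=> g a x.
  have := ribbon_trace_cross (mulgV a) Ll lam_int lamL factor1 x (erefl (cj g a)).
  by rewrite /cross recast_id.
Qed.
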